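(* Let $\mu>0$, $v>0$, $\tau\in\mathbb{R}\setminus\{0,1,-1\}$. Consider the system $$-u''-|u|^{2\mu}u+\omega u=0 \ (x\neq0),\quad u\in H^2(\mathbb{R}\setminus\{0\}),\quad u(0+)=\tau u(0-),\quad u'(0-)-\tau u'(0+)=v\,u(0-).\qquad ( * )$$ 1. For $\omega\le \frac{v^2}{(\tau^2+1)^2}$ the system $( * )$ has no solutions. 2. For every $\omega\in\left(\frac{v^2}{(\tau^2+1)^2},\frac{v^2}{(\tau^2-1)^2}\right]$ there exists a unique solution of $( * )$. 3. For $\omega>\frac{v^2}{(\tau^2-1)^2}$ a new branch of solutions arises separately from the previous one and there are two solutions of $( * )$. All solutions have the form $$u_\omega(x)=\begin{cases}\phi_\omega(x+x_-), & x\in\mathbb{R}_-,\\ \phi_\omega(x+x_+), & x\in\mathbb{R}_+,\end{cases}$$ where $x_-,x_+\in\mathbb{R}$ are given by the solutions of the system $$T_+=\frac1{\tau^2}\left(T_-+\frac{v}{\sqrt\omega}\right),\qquad \frac{T_-^2}{1-\frac1{\tau^{2\mu}}}-\frac{T_+^2}{\tau^{2\mu}-1}=1$$ in the unknowns $T_\pm=T_\pm(\omega)=\tanh(\mu\sqrt\omega\,x_\pm)$.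
   Context: $\phi_\omega(x)=(\omega(\mu+1))^{\frac1{2\mu}}\cosh^{-\frac1\mu}(\mu\sqrt\omega\,x)$ is the soliton. $\mathbb{R}_-=(-\infty,0)$, $\mathbb{R}_+=(0,+\infty)$; $u(0\pm)$, $u'(0\pm)$ denote one-sided limits at the origin. The authors remark that it is not restrictive to suppose $\tau>0$.
   Formalization: Solutions are taken not identically zero and counted up to a constant factor of modulus 1 (u=0 and cu, |c|=1, otherwise break items 1–3 and the form); for τ<0, where the printed form fails, the piece on R_+ carries the sign of τ and τ^{2μ} is read as |τ|^{2μ}. *)

(* Defs.v *)
From HB Require Import structures.
From mathcomp Require Import all_boot all_order all_algebra complex.
From mathcomp Require Import all_classical all_reals all_analysis.
Set Implicit Arguments.
Unset Strict Implicit.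
Unset Printing Implicit Defensive.
Import Order.TTheory GRing.Theory Num.Theory numFieldNormedType.Exports.
Local Open Scope classical_set_scope.
Local Open Scope complex_scope.
Local Open Scope ring_scope.

Definition cosh (R : realType) (x : R) : R := (expR x + expR (- x)) / 2.

Definition tanh (R : realType) (x : R) : R :=
  (expR x - expR (- x)) / (expR x + expR (- x)).

Definition punctured_line (R : realType) : set R := [set x | x != 0].

(* C^1_c test functions, as in Brezis's definition of one-dimensional Sobolev
   spaces. *)
Definition test_function (R : realType) (Omega : set R) (phi : R -> R) : Prop :=
  [/\ forall x, derivable phi x 1,
      continuous (derive1 phi : R -> R)
    & exists K : set R,
        [/\ compact K, K `<=` Omega & forall x, ~ K x -> phi x = 0]].

Definition weak_derivative (R : realType) (Omega : set R) (f g : R -> R) : Prop :=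
  forall phi : R -> R, test_function Omega phi ->
    \int[@lebesgue_measure R]_(x in Omega) (f x * derive1 phi x) =
    - \int[@lebesgue_measure R]_(x in Omega) (g x * phi x).

(* Real test functions suffice for complex-valued functions, by linearity. *)
Definition weak_derivativeC (R : realType) (Omega : set R) (f g : R -> R[i]) : Prop :=
  weak_derivative Omega (fun x => complex.Re (f x)) (fun x => complex.Re (g x)) /\
  weak_derivative Omega (fun x => complex.Im (f x)) (fun x => complex.Im (g x)).

(* The origin is a null set, so L^2(R \ {0}) is L^2(R). *)
Definition L2 (R : realType) (f : R -> R[i]) : Prop :=
  (fun x => complex.Re (f x)) \in Lfun (@lebesgue_measure R) 2%:E /\
  (fun x => complex.Im (f x)) \in Lfun (@lebesgue_measure R) 2%:E.

Definition continuous_off0 (R : realType) (f : R -> R[i]) : Prop :=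
  forall x : R, x != 0 -> {for x, continuous (f : R -> (R[i] : numFieldType))}.

(* u is in H^2(R \ {0}) with weak derivatives u' = u1 and u'' = u2, where u and
   u1 are the continuous representatives of their a.e. classes on R \ {0}
   (these exist by the Sobolev embedding on each half-line); the values of u,
   u1, u2 at the origin are irrelevant. *)
Definition H2_off0 (R : realType) (u u1 u2 : R -> R[i]) : Prop :=
  [/\ [/\ L2 u, L2 u1 & L2 u2],
      weak_derivativeC (@punctured_line R) u u1,
      weak_derivativeC (@punctured_line R) u1 u2,
      continuous_off0 u
    & continuous_off0 u1].

Definition stationary_eq (R : realType) (mu omega : R) (u u2 : R -> R[i]) : Prop :=
  {ae @lebesgue_measure R, forall x, x != 0 ->
    - u2 x - (Normc.normc (u x) `^ (2 * mu))%:C * u x + omega%:C * u x = 0}.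

Definition vertex_condition (R : realType) (tau v : R) (u u1 : R -> R[i]) : Prop :=
  exists ul ur dl dr : (R[i] : numFieldType),
    [/\ u x @[x --> (0 : R)^'-] --> ul,
        u x @[x --> (0 : R)^'+] --> ur,
        u1 x @[x --> (0 : R)^'-] --> dl
      & u1 x @[x --> (0 : R)^'+] --> dr] /\
    (ur = tau%:C * ul /\ dl - tau%:C * dr = v%:C * ul).

(* The zero function always satisfies the system; "solution" means a solution
   that is not identically zero. *)
Definition solution (R : realType) (mu tau v omega : R) (u : R -> R[i]) : Prop :=
  (exists x : R, x != 0 /\ u x != 0) /\
  exists u1 u2 : R -> R[i],
    [/\ H2_off0 u u1 u2,
        stationary_eq mu omega u u2
      & vertex_condition tau v u u1].

(* The system is invariant under u |-> c u with |c| = 1: solutions are counted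
   up to such a factor, and up to the value at the origin. *)
Definition phase_equiv (R : realType) (u w : R -> R[i]) : Prop :=
  exists c : R[i], Normc.normc c = 1 /\ forall x : R, x != 0 -> u x = c * w x.

Definition soliton (R : realType) (mu omega x : R) : R :=
  ((omega * (mu + 1)) `^ (2 * mu)^-1) *
  (cosh (mu * Num.sqrt omega * x) `^ (- mu^-1)).

(* For tau > 0 the sign is 1. Replacing tau by - tau amounts to changing the
   sign of u on the positive half-line. *)
Definition matched_soliton (R : realType) (mu tau omega xm xp : R) (x : R) : R[i] :=
  (if x < 0 then soliton mu omega (x + xm)
   else Num.sg tau * soliton mu omega (x + xp))%:C.

Definition T_of (R : realType) (mu omega x : R) : R :=
  tanh (mu * Num.sqrt omega * x).

(* |tau| is tau when tau > 0; powR takes a junk value at a negative base. *)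
Definition T_system (R : realType) (mu tau v omega Tm Tp : R) : Prop :=
  Tp = (tau ^+ 2)^-1 * (Tm + v / Num.sqrt omega) /\
  Tm ^+ 2 / (1 - (`|tau| `^ (2 * mu))^-1) -
  Tp ^+ 2 / (`|tau| `^ (2 * mu) - 1) = 1.

Definition omega_lo (R : realType) (tau v : R) : R := v ^+ 2 / (tau ^+ 2 + 1) ^+ 2.
Definition omega_hi (R : realType) (tau v : R) : R := v ^+ 2 / (tau ^+ 2 - 1) ^+ 2.

(* A branch of solutions over the frequencies omega > omega0. *)
Definition solution_branch (R : realType) (mu tau v omega0 : R)
    (xm xp : R -> R) : Prop :=
  forall omega, omega0 < omega ->
    [/\ {for omega, continuous xm}, {for omega, continuous xp}
      & solution mu tau v omega
          (matched_soliton mu tau omega (xm omega) (xp omega))].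

(* The curves traced by the two branches in the plane (T_-, T_+) are at
   positive distance: in particular the second branch does not bifurcate from
   the first as omega decreases to omega2. *)
Definition separated_branches (R : realType) (mu omega1 omega2 : R)
    (xm1 xp1 xm2 xp2 : R -> R) : Prop :=
  exists d : R, 0 < d /\
    forall w1 w2, omega1 < w1 -> omega2 < w2 ->
      d <= Num.max `|T_of mu w1 (xm1 w1) - T_of mu w2 (xm2 w2)|
                   `|T_of mu w1 (xp1 w1) - T_of mu w2 (xp2 w2)|.

(* Main.v *)
Require Import Defs.
From HB Require Import structures.
From mathcomp Require Import all_boot all_order all_algebra complex.
From mathcomp Require Import all_classical all_reals all_analysis.
From mathcomp Require Import measurable_realfun ring lra.
Set Implicit Arguments.
Unset Strict Implicit.
Unset Printing Implicit Defensive.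
Import Order.TTheory GRing.Theory Num.Theory numFieldNormedType.Exports.
Local Open Scope classical_set_scope.
Local Open Scope complex_scope.
Local Open Scope ring_scope.

(** On each half-line the weak equation is classical: the mean value inequality
    for weak derivatives, tested against quadratic splines, shows that u and u'
    are differentiable off the origin. Energy and angular momentum are then
    conserved, and they vanish by square integrability. Vanishing angular
    momentum makes the phase constant, while zero energy makes
    T = - rho' / (sqrt omega rho), with rho = |u|, solve
    T' = mu sqrt omega (1 - T^2) with |T| < 1; so T is a translate of tanh and
    rho of the soliton.

    The vertex conditions become s P = T + q and 1 - P^2 = a (1 - T^2) for
    T = T_-, P = T_+, s = tau^2, a = |tau|^(2 mu), q = v / sqrt omega. This is a
    quadratic equation with two roots, and |T| < 1 holds for one of them iff
    q < s + 1, for the other one iff q < |s - 1|. *)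

(** * The two roots of the matching system *)

(** The quadratic always has two real roots because [a] and [s] are powers of [|tau|] with positive
    exponents, so that [a - 1], [s - 1] and [a s^2 - 1] share a sign. Bounding a root by 1 means
    comparing a square root with a polynomial, and squaring is licit only when signs are known.
    Which of T and P has a known sign depends on the side of 1 where [s] lies, hence the two cases
    in each estimate.

    On the analytic side, u may a priori vanish, u'' is only square integrable, and the equation
    holds almost everywhere. The energy is therefore expressed through N = |u|^2, which is
    differentiable even at zeros of u. That a nonzero solution on a half-line has no zeros there
    comes from |N'| <= 2 sqrt omega N, not from uniqueness for the Cauchy problem. The conserved
    quantities need only points where u and u' are small, not a limit at infinity. *)

Section BranchAlgebra.
Variables (R : realType) (s a q : R).

(** Eliminating T by [T = s P - q] gives [(a s^2 - 1) P^2 - 2 a s q P + (a q^2 + 1 - a) = 0]. A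
    quarter of its discriminant stands under the root, and [e] is the sign in front of the root. *)
Definition branch_radius : R := Num.sqrt (a * q ^+ 2 + (a * s ^+ 2 - 1) * (a - 1)).
Definition branch_minus (e : R) : R := (q + e * s * branch_radius) / (a * s ^+ 2 - 1).
Definition branch_plus (e : R) : R :=
  (a * s * q + e * branch_radius) / (a * s ^+ 2 - 1).

End BranchAlgebra.

(** The leading coefficient of the quadratic takes the sign of [a - 1]. This makes the discriminant
    positive and gives the two cases along which every estimate below splits. *)
Lemma same_side_discr (R : realType) (s a : R) : 0 < s -> 0 < a ->
  0 < (a - 1) * (s - 1) ->
  [/\ 1 < s, 1 < a & 0 < a * s ^+ 2 - 1] \/
  [/\ s < 1, a < 1 & a * s ^+ 2 - 1 < 0].
Proof.
move=> s0 a0 h; case: (ltrP 1 s) => s1.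
  have a1 : 1 < a by nra.
  by left; split => //; rewrite subr_gt0; nra.
have s1' : s < 1 by rewrite lt_neqAle s1 andbT; apply/eqP => E; move: h; rewrite E subrr mulr0 ltxx.
have a1 : a < 1 by nra.
right; split => //; rewrite subr_lt0.
have : a * s ^+ 2 < 1 * s ^+ 2 by rewrite ltr_pM2r // exprn_gt0.
nra.
Qed.

Lemma branch_radiusP (R : realType) (s a q : R) : 0 < s -> 0 < a -> 0 < q ->
  0 < (a - 1) * (s - 1) ->
  0 < branch_radius s a q /\
  branch_radius s a q ^+ 2 = a * q ^+ 2 + (a * s ^+ 2 - 1) * (a - 1).
Proof.
move=> s0 a0 q0 h.
have h0 : 0 < a * q ^+ 2 + (a * s ^+ 2 - 1) * (a - 1).
  have : 0 < a * q ^+ 2 by rewrite mulr_gt0 // exprn_gt0.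
  by case: (same_side_discr s0 a0 h) => -[_ a1 A0]; nra.
by split; rewrite /branch_radius ?sqrtr_gt0 // sqr_sqrtr // ltW.
Qed.

Lemma branch_system (R : realType) (s a q T P : R) : 0 < s -> 0 < a -> 0 < q ->
  0 < (a - 1) * (s - 1) ->
  (s * P = T + q /\ 1 - P ^+ 2 = a * (1 - T ^+ 2)) <->
  (T = branch_minus s a q (-1) /\ P = branch_plus s a q (-1)) \/
  (T = branch_minus s a q 1 /\ P = branch_plus s a q 1).
Proof.
move=> s0 a0 q0 h; have [r0 r2] := branch_radiusP s0 a0 q0 h.
have A0 : a * s ^+ 2 - 1 != 0.
  by case: (same_side_discr s0 a0 h) => -[_ _ A]; [rewrite gt_eqF|rewrite lt_eqF].
rewrite /branch_minus /branch_plus; set r := branch_radius s a q in r0 r2 *.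
split => [[h1 h2]|].
  have TE : T = s * P - q by rewrite h1 addrK.
  (* The quadratic in P multiplied by its leading coefficient, with the square completed. *)
  have : ((a * s ^+ 2 - 1) * P - a * s * q) ^+ 2 = r ^+ 2.
    rewrite r2; move: h2; rewrite TE => h2.
    transitivity (a * q ^+ 2 + (a * s ^+ 2 - 1) * (a - 1)
      + (a * s ^+ 2 - 1) * ((1 - P ^+ 2) - a * (1 - (s * P - q) ^+ 2))); first by ring.
    by rewrite h2; ring.
  move/eqP; rewrite eqf_sqr => /orP[] /eqP E; [right|left]; rewrite TE.
    have -> : P = (a * s * q + r) / (a * s ^+ 2 - 1).
      by apply: (mulIf A0); rewrite divfK // -E; ring.
    by split; field.
  have -> : P = (a * s * q - r) / (a * s ^+ 2 - 1).
    by apply: (mulIf A0); rewrite divfK //; move/eqP: E; rewrite subr_eq => /eqP E; rewrite mulrC E; ring.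
  by split; field.
by case=> -[-> ->]; split; try (by field);
  (apply/eqP; rewrite -subr_eq0; apply/eqP;
   transitivity ((r ^+ 2 - (a * q ^+ 2 + (a * s ^+ 2 - 1) * (a - 1))) / (a * s ^+ 2 - 1));
   [field|rewrite r2 subrr mul0r]).
Qed.

(* Hence it is enough to control the unknown whose sign is known. *)
Lemma range_iff (R : realType) (a T P : R) : 0 < a ->
  1 - P ^+ 2 = a * (1 - T ^+ 2) -> (`|P| < 1) = (`|T| < 1).
Proof.
move=> a0 h.
have E (x : R) : (`|x| < 1) = (0 < 1 - x ^+ 2).
  by rewrite subr_gt0 -real_normK ?num_real // expr_lt1.
by rewrite !E h pmulr_rgt0.
Qed.

(** Removes the square root from comparisons with [branch_radius]: once squared, each difference
    below factors. *)
Lemma sqr_ltE (R : realType) (x y : R) : 0 <= y ->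
  (0 < y ^+ 2 - x ^+ 2) = (`|x| < y).
Proof.
by move=> y0; rewrite subr_gt0 -(real_normK (num_real x)) ltr_pXn2r ?nnegrE.
Qed.

(** Write [A = a s^2 - 1] and r for the radius. For [s > 1] this T is negative, so the bound reads
    [s r < A + q]; squared, it factors as [A (s^2 - (q - 1)^2) > 0], that is [|q - 1| < s]. For
    [s < 1] it is P whose sign is known, and [|P| < 1] becomes [|q - s| < 1]. In both cases one half
    of the condition is automatic and [q < s + 1] remains. *)
Lemma branch_old_range (R : realType) (s a q : R) : 0 < s -> 0 < a -> 0 < q ->
  0 < (a - 1) * (s - 1) ->
  (`|branch_minus s a q (-1)| < 1) = (q < s + 1).
Proof.
move=> s0 a0 q0 h; have [r0 r2] := branch_radiusP s0 a0 q0 h.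
have [_ E2] := (branch_system (branch_minus s a q (-1)) (branch_plus s a q (-1))
  s0 a0 q0 h).2 (or_introl (conj erefl erefl)).
case: (same_side_discr s0 a0 h) => -[s1 a1 A0].
  rewrite /branch_minus; set r := branch_radius s a q in r0 r2 *.
  set A := a * s ^+ 2 - 1 in A0 r2 *.
  have neg : q < s * r.
    rewrite -(gtr0_norm q0) -sqr_ltE; last by rewrite mulr_ge0 // ltW.
    have -> : (s * r) ^+ 2 - q ^+ 2 = A * (q ^+ 2 + s ^+ 2 * (a - 1)).
      by rewrite exprMn r2 /A; ring.
    by rewrite mulr_gt0 // addr_gt0 ?mulr_gt0 ?exprn_gt0 // subr_gt0.
  rewrite normrM normfV (gtr0_norm A0) ltr_pdivrMr // mul1r ltr0_norm; last by lra.
  have -> : (- (q + -1 * s * r) < A) = (`|s * r| < A + q).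
    rewrite gtr0_norm ?mulr_gt0 //; apply/idP/idP; lra.
  rewrite -sqr_ltE; last by rewrite addr_ge0 // ltW.
  have -> : (A + q) ^+ 2 - (s * r) ^+ 2 = A * (s ^+ 2 - (q - 1) ^+ 2).
    by rewrite exprMn r2 /A; ring.
  rewrite pmulr_rgt0 // sqr_ltE; last by rewrite ltW.
  by rewrite ltr_norml; apply/andP/idP => [[]|]; [|split]; lra.
rewrite -(range_iff a0 E2) /branch_plus; set r := branch_radius s a q in r0 r2 *.
set A := a * s ^+ 2 - 1 in A0 r2 *.
have neg : a * s * q < r.
  rewrite -(@gtr0_norm _ (a * s * q)) ?mulr_gt0 // -sqr_ltE; last by rewrite ltW.
  have -> : r ^+ 2 - (a * s * q) ^+ 2 = - A * (a * q ^+ 2 + (1 - a)).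
    by rewrite r2 /A; ring.
  by rewrite mulr_gt0 ?oppr_gt0 // addr_gt0 ?mulr_gt0 ?exprn_gt0 // subr_gt0.
rewrite normrM normfV (ltr0_norm A0) ltr_pdivrMr ?oppr_gt0 // mul1r ltr0_norm; last by lra.
have -> : (- (a * s * q + -1 * r) < - A) = (`|r| < a * s * q - A).
  rewrite gtr0_norm //; apply/idP/idP; lra.
rewrite -sqr_ltE; last by rewrite subr_ge0 ltW // (lt_trans A0) // !mulr_gt0.
have -> : (a * s * q - A) ^+ 2 - r ^+ 2 = - A * a * (1 ^+ 2 - (q - s) ^+ 2).
  by rewrite r2 /A; ring.
rewrite pmulr_rgt0 ?mulr_gt0 ?oppr_gt0 // sqr_ltE //.
by rewrite ltr_norml; apply/andP/idP => [[]|]; [|split]; lra.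
Qed.

(** Same scheme with the other sign of the root. For [s > 1] the condition becomes [q + 1 < s], and
    for [s < 1], read on P, it becomes [q + s < 1]. *)
Lemma branch_new_range (R : realType) (s a q : R) : 0 < s -> 0 < a -> 0 < q ->
  0 < (a - 1) * (s - 1) ->
  (`|branch_minus s a q 1| < 1) = (q < `|s - 1|).
Proof.
move=> s0 a0 q0 h; have [r0 r2] := branch_radiusP s0 a0 q0 h.
have [_ E2] := (branch_system (branch_minus s a q 1) (branch_plus s a q 1)
  s0 a0 q0 h).2 (or_intror (conj erefl erefl)).
case: (same_side_discr s0 a0 h) => -[s1 a1 A0].
  rewrite /branch_minus; set r := branch_radius s a q in r0 r2 *.
  set A := a * s ^+ 2 - 1 in A0 r2 *.
  have sr0 : 0 < s * r by rewrite mulr_gt0.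
  rewrite normrM normfV (gtr0_norm A0) ltr_pdivrMr // !mul1r.
  rewrite (@gtr0_norm _ (q + s * r)); last by lra.
  (* Squaring requires [A - q] to be positive. Otherwise both sides of the equivalence fail, since
     [s - 1 < A <= q]. *)
  have [qA|Aq] := ltP q A; last first.
    have sA : s - 1 < A by rewrite /A; nra.
    rewrite (@gtr0_norm _ (s - 1)); last by lra.
    by apply/idP/idP; lra.
  have -> : (q + s * r < A) = (`|s * r| < A - q).
    by rewrite gtr0_norm //; apply/idP/idP; lra.
  rewrite -sqr_ltE; last by rewrite subr_ge0 ltW.
  have -> : (A - q) ^+ 2 - (s * r) ^+ 2 = A * (s ^+ 2 - (q + 1) ^+ 2).
    by rewrite exprMn r2 /A; ring.
  rewrite pmulr_rgt0 // sqr_ltE ?(ltW s0) // !gtr0_norm; lra.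
rewrite -(range_iff a0 E2) /branch_plus; set r := branch_radius s a q in r0 r2 *.
set A := a * s ^+ 2 - 1 in A0 r2 *.
have asq0 : 0 < a * s * q by rewrite !mulr_gt0.
rewrite normrM normfV (ltr0_norm A0) ltr_pdivrMr ?oppr_gt0 // !mul1r.
rewrite (@gtr0_norm _ (a * s * q + r)); last by lra.
rewrite (@ltr0_norm _ (s - 1)); last by lra.
have [qA|Aq] := ltP (a * s * q) (- A); last first.
  have as0 : 0 < a * s by rewrite mulr_gt0.
  have sA : a * s * (1 - s) < - A by rewrite /A; nra.
  apply/idP/idP; first by lra.
  move=> qs; have : a * s * q < a * s * (1 - s) by rewrite ltr_pM2l //; lra.
  by lra.
have -> : (a * s * q + r < - A) = (`|r| < - A - a * s * q).
  by rewrite gtr0_norm //; apply/idP/idP; lra.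
rewrite -sqr_ltE; last by rewrite subr_ge0 ltW.
have -> : (- A - a * s * q) ^+ 2 - r ^+ 2 = - A * a * (1 ^+ 2 - (q + s) ^+ 2).
  by rewrite r2 /A; ring.
rewrite pmulr_rgt0 ?mulr_gt0 ?oppr_gt0 // sqr_ltE // gtr0_norm ?addr_gt0 //.
by apply/idP/idP; lra.
Qed.

(* On one side of [a = 1] the branches are separated by the sign of T, on the
   other one by the sign of P. *)
Lemma branch_separation (R : realType) (s a : R) : 0 < s -> 0 < a ->
  0 < (a - 1) * (s - 1) ->
  exists2 d : R, 0 < d & forall q1 q2, 0 < q1 -> 0 < q2 ->
    d <= Num.max `|branch_minus s a q1 (-1) - branch_minus s a q2 1|
                 `|branch_plus s a q1 (-1) - branch_plus s a q2 1|.
Proof.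
move=> s0 a0 h.
have rad (q : R) : 0 < q ->
    Num.sqrt ((a * s ^+ 2 - 1) * (a - 1)) < branch_radius s a q.
  move=> q0; rewrite /branch_radius ltr_sqrt ?ltrDr ?mulr_gt0 ?exprn_gt0 //.
  by have [_ <-] := branch_radiusP s0 a0 q0 h; rewrite exprn_gt0 // (branch_radiusP s0 a0 q0 h).1.
case: (same_side_discr s0 a0 h) => -[s1 a1 A0].
  have m0 : 0 < Num.sqrt ((a * s ^+ 2 - 1) * (a - 1)).
    by rewrite sqrtr_gt0 mulr_gt0 // subr_gt0.
  (* The value of the second root T at [q = 0], which bounds it from below for [q > 0] because the
     radius grows with [q]; the first root is negative. *)
  exists (s * Num.sqrt ((a * s ^+ 2 - 1) * (a - 1)) / (a * s ^+ 2 - 1)).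
    by rewrite divr_gt0 // mulr_gt0.
  move=> q1 q2 q10 q20; rewrite le_max; apply/orP; left.
  have [r10 r12] := branch_radiusP s0 a0 q10 h.
  have l2 := rad _ q20.
  rewrite distrC; apply: le_trans (ler_norm _).
  rewrite /branch_minus -mulrBl ler_pM2r ?invr_gt0 //.
  have n1 : q1 < s * branch_radius s a q1.
    rewrite -[ltLHS](gtr0_norm q10) -sqr_ltE; last by rewrite mulr_ge0 // ltW.
    have -> : (s * branch_radius s a q1) ^+ 2 - q1 ^+ 2 =
        (a * s ^+ 2 - 1) * (q1 ^+ 2 + s ^+ 2 * (a - 1)).
      by rewrite exprMn r12; ring.
    by rewrite mulr_gt0 // addr_gt0 ?mulr_gt0 ?exprn_gt0 // subr_gt0.
  have : s * Num.sqrt ((a * s ^+ 2 - 1) * (a - 1)) < s * branch_radius s a q2.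
    by rewrite ltr_pM2l.
  lra.
have m0 : 0 < Num.sqrt ((a * s ^+ 2 - 1) * (a - 1)).
  by rewrite sqrtr_gt0 nmulr_rgt0 // subr_lt0.
(* Minus the value of the second root P at [q = 0]. Here [a s^2 - 1] is negative, so the second P
   lies below minus this constant while the first P is positive. *)
exists (Num.sqrt ((a * s ^+ 2 - 1) * (a - 1)) / - (a * s ^+ 2 - 1)).
  by rewrite divr_gt0 // oppr_gt0.
move=> q1 q2 q10 q20; rewrite le_max; apply/orP; right.
have [r10 r12] := branch_radiusP s0 a0 q10 h.
have l2 := rad _ q20.
apply: le_trans (ler_norm _).
rewrite /branch_plus -mulrBl -[leRHS]mulrNN -invrN ler_pM2r ?invr_gt0 ?oppr_gt0 //.
have n1 : a * s * q1 < branch_radius s a q1.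
  rewrite -(@gtr0_norm _ (a * s * q1)) ?mulr_gt0 // -sqr_ltE; last by rewrite ltW.
  have -> : branch_radius s a q1 ^+ 2 - (a * s * q1) ^+ 2 =
      - (a * s ^+ 2 - 1) * (a * q1 ^+ 2 + (1 - a)) by rewrite r12; ring.
  by rewrite mulr_gt0 ?oppr_gt0 // addr_gt0 ?mulr_gt0 ?exprn_gt0 // subr_gt0.
have : 0 < a * s * q2 by rewrite !mulr_gt0.
lra.
Qed.

(** * Derivatives and weak derivatives *)

Lemma is_derive_continuous (R : realType) (f : R -> R) (x d : R) :
  is_derive x 1 f d -> {for x, continuous f}.
Proof. by move=> [df _]; apply/differentiable_continuous/derivable1_diffP. Qed.

Lemma is_derive_linear_bound (R : realType) (f : R -> R) (x d : R) :
  (forall e, 0 < e -> \forall y \near x,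
     `|f y - f x - d * (y - x)| <= e * `|y - x|) ->
  is_derive x 1 f d.
Proof.
move=> H.
suff cv : (fun h : R => h^-1 *: ((f \o shift x) (h *: 1) - f x)) @ 0^' --> d.
  by apply: DeriveDef; [apply/cvg_ex; exists d | exact: cvg_lim cv].
apply/cvgrPdist_le => e e0.
have [r /= r0 Hr] := (nbhs_normP _ _).1 (H e e0).
near=> h.
have h0 : h != 0 by near: h; exact: nbhs_dnbhs_neq.
have hr : `|h| < r by near: h; exact: dnbhs0_lt.
have := Hr (h + x); rewrite /= opprD addrCA subrr addr0 normrN => /(_ hr).
rewrite addrK /GRing.scale /= mulr1 => Hb.
rewrite -(ler_pM2r (_ : 0 < `|h|)) ?normr_gt0 //.
apply: le_trans Hb; rewrite -normrM distrC mulrBl mulrAC mulVf // mul1r.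
exact: lexx.
Unshelve. all: by end_near. Qed.

Lemma zero_derive_constant (R : realType) (f : R -> R) (a b : R) : a <= b ->
  (forall x, a <= x <= b -> is_derive x 1 f 0) -> f a = f b.
Proof.
move=> ab H; apply/esym/eqP; rewrite -subr_eq0; apply/eqP.
have [||c _ ->] := @MVT_segment R f (fun=> 0) a b ab; last by rewrite mul0r.
  by move=> x; rewrite in_itv /= => /andP[/ltW ax /ltW xb]; apply: H; rewrite ax.
apply: derivable_within_continuous => x; rewrite in_itv /= => /H [].
by [].
Qed.

Lemma nonneg_derive_le (R : realType) (f df : R -> R) (a b : R) : a <= b ->
  (forall x, a <= x <= b -> is_derive x 1 f (df x)) ->
  (forall x, a <= x <= b -> 0 <= df x) -> f a <= f b.
Proof.
move=> ab H pos; rewrite -subr_ge0.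
have [||c] := @MVT_segment R f df a b ab.
- by move=> x; rewrite in_itv /= => /andP[/ltW ax /ltW xb]; apply: H; rewrite ax.
- apply: derivable_within_continuous => x; rewrite in_itv /= => /H [].
  by [].
by rewrite in_itv /= => /pos dfc ->; rewrite mulr_ge0 // subr_ge0.
Qed.

(** The odd extension of the power [p + 1], differentiable at 0 too. With [p = mu] it is the
    potential energy as a function of |u|^2, which may vanish; with [p = 1] it generates the
    quadratic splines. *)
Lemma is_derive_mul_powR_norm (R : realType) (p t : R) : 0 < p ->
  is_derive t 1 (fun t => t * `|t| `^ p) ((p + 1) * `|t| `^ p).
Proof.
move=> p0; have [t0|t0|->] := ltrgtP t 0.
- apply: (@near_eq_is_derive _ _ _ (fun y => - ((- y) `^ (p + 1)))).
    near=> y; have y0 : y < 0 by near: y; exact: lt_nbhsl.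
    rewrite ltr0_norm // -[in RHS](opprK y) mulNr opprK; congr (- _).
    rewrite -(mulr_powRB1 (x := - y)) ?addr_gt0 // ?oppr_ge0 ?ltW //.
    by rewrite addrK.
  have t0' : 0 < - t by rewrite oppr_gt0.
  have h1 : is_derive t 1 ((fun y : R => y `^ (p + 1)) \o (fun y : R => - y))
      ((p + 1) * (- t) `^ (p + 1 - 1) * -1).
    apply: (@is_derive1_comp R (fun y : R => y `^ (p + 1)) (fun y : R => - y)).
      exact: is_derive1_powR.
  have := is_deriveN (f := (fun y : R => y `^ (p + 1)) \o (fun y : R => - y)) h1.
  by rewrite addrK ltr0_norm // mulrN mulr1 opprK.
- apply: (@near_eq_is_derive _ _ _ (fun y => y `^ (p + 1))).
    near=> y; have y0 : 0 < y by near: y; exact: lt_nbhsr.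
    by rewrite gtr0_norm // -(mulr_powRB1 (x := y)) ?addr_gt0 // ?ltW // addrK.
  have := is_derive1_powR (p + 1) t0.
  by rewrite addrK gtr0_norm.
rewrite normr0 powR0 ?gt_eqF // mulr0.
apply: is_derive_linear_bound => e e0.
have [r /= r0 Hr] : \forall a \near 0^'+, `|a `^ p| < e.
  have /cvgrPdist_lt /(_ e e0) := @powR_cvg0 R p p0.
  by apply: filterS => a; rewrite sub0r normrN.
near=> y; rewrite !mul0r !subr0 normrM mulrC.
have [->|y0] := eqVneq y 0; first by rewrite normr0 !mulr0.
rewrite ler_wpM2r //; apply/ltW/Hr; last by rewrite normr_gt0.
rewrite /= sub0r normrN normr_id.
by near: y; apply: (@nbhs0_lt R R^o).
Unshelve. all: by end_near. Qed.

Section SegmentIntegrals.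
Variable R : realType.
Notation leb := (@lebesgue_measure R).

Lemma Rintegral_eq_domain (D E : set R) (f : R -> R) :
  (forall x, f x != 0 -> D x <-> E x) ->
  \int[leb]_(x in D) f x = \int[leb]_(x in E) f x.
Proof.
move=> H; rewrite Rintegral_mkcond [RHS]Rintegral_mkcond; congr fine.
apply: eq_integral => x _; congr (_ %:E); rewrite /patch.
have [->|/H DE] := eqVneq (f x) 0; first by rewrite !if_same.
suff -> : (x \in D) = (x \in E) by [].
by apply/idP/idP => /set_mem /DE xE; apply: mem_set.
Qed.

Lemma segment_within_continuous (f : R -> R) (a b : R) :
  (forall x, a <= x <= b -> {for x, continuous f}) ->
  {within `[a, b], continuous f}.
Proof.
move=> H; apply: continuous_in_subspaceT => x; rewrite inE /= in_itv /=.
exact: H.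
Qed.

Lemma segment_integrable (f : R -> R) (a b : R) :
  (forall x, a <= x <= b -> {for x, continuous f}) ->
  leb.-integrable `[a, b] (EFin \o f).
Proof.
move=> H; apply: continuous_compact_integrable; first exact: segment_compact.
exact: segment_within_continuous.
Qed.

Lemma Rintegral_derive (F f : R -> R) (a b : R) : a < b ->
  (forall x, a <= x <= b -> is_derive x 1 F (f x)) ->
  (forall x, a <= x <= b -> {for x, continuous f}) ->
  \int[leb]_(x in `[a, b]) f x = F b - F a.
Proof.
move=> ab dF cf.
have cF x : a <= x <= b -> {for x, continuous F} by move=> /dF /is_derive_continuous.
rewrite /Rintegral (@continuous_FTC2 R f F a b ab) //.
- exact: segment_within_continuous.
- split.
  + move=> x; rewrite in_itv /= => /andP[/ltW ax /ltW xb].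
    by have [] := dF x (introT andP (conj ax xb)).
  + by apply/cvg_at_right_filter/cF; rewrite lexx ltW.
  + by apply/cvg_at_left_filter/cF; rewrite lexx ltW.
- move=> x; rewrite in_itv /= => /andP[/ltW ax /ltW xb].
  by rewrite derive1E; have [_ ->] := dF x (introT andP (conj ax xb)).
Qed.

End SegmentIntegrals.

(** * Quadratic splines *)

Section TestFunction.
Variable R : realType.

(* Up to a factor, a C^1 smoothing of the step on [c, c + 2 d] : its derivative
   is a tent, so it is a second difference of the primitive of the norm. *)
Definition spline_step (c d y : R) : R :=
  (y - c) * `|y - c| - (y - c - d) * `|y - c - d| *+ 2
  + (y - c - d *+ 2) * `|y - c - d *+ 2|.
Definition tent (c d y : R) : R :=
  (`|y - c| - `|y - c - d| *+ 2 + `|y - c - d *+ 2|) *+ 2.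

Lemma is_derive_shifted_square (c y : R) :
  is_derive y 1 (fun y => (y - c) * `|y - c|) (`|y - c| *+ 2).
Proof.
have h : is_derive (y - c) 1 (fun t : R => t * `|t|) (`|y - c| *+ 2).
  have := @is_derive_mul_powR_norm R 1 (y - c) ltr01.
  rewrite powRr1 // -[1 + 1]/(2%:R) mulr_natl.
  by under eq_fun do rewrite powRr1 //.
have h2 : is_derive y 1 (fun y : R => y - c) 1.
  by apply: trigger_derive; rewrite subr0.
by have := @is_derive1_comp R _ (fun y => y - c) y _ _ h h2; rewrite mulr1.
Qed.

Lemma is_derive_spline_step (c d y : R) :
  is_derive y 1 (spline_step c d) (tent c d y).
Proof.
have e (w z : R) : w - c - z = w - (c + z) by rewrite opprD addrA.
have h0 := is_derive_shifted_square c y.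
have h1 := is_derive_shifted_square (c + d) y.
have h2 := is_derive_shifted_square (c + d *+ 2) y.
have -> : spline_step c d = (fun y => (y - c) * `|y - c|)
   - (fun y => (y - (c + d)) * `|y - (c + d)|)
   - (fun y => (y - (c + d)) * `|y - (c + d)|)
   + (fun y => (y - (c + d *+ 2)) * `|y - (c + d *+ 2)|).
  by apply/funext => z; rewrite /spline_step !fctE !e; ring.
have -> : tent c d y = `|y - c| *+ 2 - `|y - (c + d)| *+ 2
   - `|y - (c + d)| *+ 2 + `|y - (c + d *+ 2)| *+ 2.
  by rewrite /tent !e; ring.
apply: is_deriveD.
Qed.

Lemma continuous_tent (c d : R) : continuous (tent c d).
Proof.
have cn (k : R) : continuous (fun y : R => `|y - k|).
  move=> y; apply: (@continuous_comp _ _ _ (fun y => y - k) Num.norm).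
    by apply: continuousB; [exact: cvg_id | exact: cvg_cst].
  exact: norm_continuous.
have -> : tent c d = (fun y => (`|y - c| - `|y - (c + d)| *+ 2 + `|y - (c + d *+ 2)|) *+ 2).
  by apply/funext => y; rewrite /tent !opprD !addrA.
move=> y; rewrite /continuous_at.
by apply: cvgMn; apply: cvgD; [apply: cvgB; [|apply: cvgMn]|]; exact: cn.
Qed.

(** The middle node is the midpoint of the other two, so this is convexity of the norm. *)
Lemma tent_ge0 (c d y : R) : 0 <= tent c d y.
Proof.
rewrite mulrn_wge0 //.
have := ler_normD (y - c) (y - c - d *+ 2).
have -> : y - c + (y - c - d *+ 2) = (y - c - d) *+ 2 by rewrite !mulr2n; ring.
by rewrite normrMn; lra.
Qed.

Lemma tent_left (c d y : R) : 0 <= d -> y <= c -> tent c d y = 0.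
Proof.
move=> d0 yc; rewrite /tent !ler0_norm; lra.
Qed.

Lemma tent_right (c d y : R) : 0 <= d -> c + d *+ 2 <= y -> tent c d y = 0.
Proof.
move=> d0 yc; rewrite /tent !ger0_norm; lra.
Qed.

Lemma spline_step_left (c d y : R) : 0 <= d -> y <= c ->
  spline_step c d y = - (d ^+ 2 *+ 2).
Proof.
move=> d0 yc; rewrite /spline_step !ler0_norm ?subr_le0 ?mulr2n; [ring|lra..].
Qed.

Lemma spline_step_right (c d y : R) : 0 <= d -> c + d *+ 2 <= y ->
  spline_step c d y = d ^+ 2 *+ 2.
Proof.
move=> d0 yc; rewrite /spline_step !ger0_norm ?mulr2n; [ring|lra..].
Qed.

Lemma spline_step_bounds (c d y : R) : 0 <= d ->
  - (d ^+ 2 *+ 2) <= spline_step c d y <= d ^+ 2 *+ 2.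
Proof.
move=> d0; apply/andP; split.
  have [yc|cy] := leP y c; first by rewrite spline_step_left.
  rewrite -(spline_step_left d0 (lexx c)).
  apply: (@nonneg_derive_le _ _ (tent c d)) => [|x _|x _]; first exact: ltW.
    exact: is_derive_spline_step.
  exact: tent_ge0.
have [yc|cy] := leP (c + d *+ 2) y; first by rewrite spline_step_right.
rewrite -(spline_step_right d0 (lexx (c + d *+ 2))).
apply: (@nonneg_derive_le _ _ (tent c d)) => [|x _|x _]; first exact: ltW.
  exact: is_derive_spline_step.
exact: tent_ge0.
Qed.

End TestFunction.

(** * The mean value inequality for weak derivatives *)

Section WeakDerivative.
Variable R : realType.
Notation leb := (@lebesgue_measure R).

(** Rises on [[a, a + 2 d]], then stays constant, then falls on [[b - 2 d, b]]. Its derivative is a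
    tent at each end, with opposite signs, so pairing it with f compares averages of f near a and
    near b. *)
Definition spline_bump (a b d y : R) : R :=
  spline_step a d y - spline_step (b - d *+ 2) d y.

Lemma is_derive_spline_bump (a b d y : R) :
  is_derive y 1 (spline_bump a b d) (tent a d y - tent (b - d *+ 2) d y).
Proof.
have h1 := is_derive_spline_step a d y.
have h2 := is_derive_spline_step (b - d *+ 2) d y.
exact: (is_deriveB h1 h2).
Qed.

Lemma derive1_spline_bump (a b d : R) :
  derive1 (spline_bump a b d) = (fun y => tent a d y - tent (b - d *+ 2) d y).
Proof.
by apply/funext => y; rewrite derive1E; have [_ ->] := is_derive_spline_bump a b d y.
Qed.

Lemma spline_bump_eq0 (a b d y : R) : 0 < d -> d *+ 4 < b - a ->
  ~~ (a <= y <= b) ->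
  spline_bump a b d y = 0 /\ tent a d y - tent (b - d *+ 2) d y = 0.
Proof.
move=> d0 dab; rewrite negb_and -!ltNge /spline_bump => /orP[ya|yb].
  by rewrite !spline_step_left ?tent_left ?subrr //; lra.
by rewrite !spline_step_right ?tent_right ?subrr //; lra.
Qed.

Lemma spline_bump_ge0 (a b d y : R) : 0 < d -> d *+ 4 < b - a ->
  0 <= spline_bump a b d y.
Proof.
move=> d0 dab; rewrite subr_ge0; have [ya|ya] := leP y (b - d *+ 2).
  rewrite (spline_step_left (ltW d0) ya).
  by have /andP[] := spline_step_bounds a y (ltW d0).
rewrite (@spline_step_right _ a) ?(ltW d0) //; last by lra.
by have /andP[] := spline_step_bounds (b - d *+ 2) y (ltW d0).
Qed.

Lemma test_function_spline_bump (Omega : set R) (a b d : R) : 0 < d ->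
  d *+ 4 < b - a -> `[a, b] `<=` Omega -> test_function Omega (spline_bump a b d).
Proof.
move=> d0 dab abO; split => [x||].
- by have [] := is_derive_spline_bump a b d x.
- rewrite derive1_spline_bump => x.
  by apply: cvgB; exact: continuous_tent.
- exists `[a, b]%classic; split => //; first exact: segment_compact.
  move=> x /= /negP; rewrite in_itv /= => xab.
  by have [] := spline_bump_eq0 d0 dab xab.
Qed.

(** Suppose [f x - M x] is larger at b than at a. A bump with short ramps then makes the integral of
    [f phi' + g phi] negative, whereas the weak identity says that it is 0. *)
Lemma weak_slope_le (Omega : set R) (f g : R -> R) (a b M : R) : a < b ->
  `[a, b] `<=` Omega -> weak_derivative Omega f g ->
  (forall x, a <= x <= b -> {for x, continuous f}) ->
  (forall x, a <= x <= b -> {for x, continuous g}) ->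
  (forall x, a <= x <= b -> g x <= M) ->
  f b - f a <= M * (b - a).
Proof.
move=> ab abO wfg cf cg gM; rewrite leNgt; apply/negP => lt_slope.
(* [r] is the midpoint between the values of [f x - M x] at a and b, and [e] a quarter of the gap;
   by continuity [f x - M x] stays below [r - e] near a and above [r + e] near b. *)
pose r := (f b - M * b + (f a - M * a)) / 2.
pose e := (f b - M * b - (f a - M * a)) / 4.
have e0 : 0 < e by rewrite divr_gt0 // ; lra.
have [d [d0 dab fl fr]] : exists d, [/\ 0 < d, d *+ 4 < b - a,
    (forall x, a <= x <= a + d *+ 2 -> f x - M * x <= r - e) &
    (forall x, b - d *+ 2 <= x <= b -> r + e <= f x - M * x)].
  have cF x : a <= x <= b -> {for x, continuous (fun x => f x - M * x)}.
    move=> xab; apply: continuousB; first exact: cf.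
    by apply: continuousM; [exact: cvg_cst | exact: cvg_id].
  have /cvgrPdist_le /(_ e e0) /nbhs_normP[da /= da0 Ha] : {for a, continuous (fun x => f x - M * x)}.
    by apply: cF; rewrite lexx ltW.
  have /cvgrPdist_le /(_ e e0) /nbhs_normP[db /= db0 Hb] : {for b, continuous (fun x => f x - M * x)}.
    by apply: cF; rewrite lexx ltW.
  pose d := Num.min (Num.min (da / 4) (db / 4)) ((b - a) / 8).
  have dda : d <= da / 4 by rewrite !ge_min lexx.
  have ddb : d <= db / 4 by rewrite !ge_min lexx !orbT.
  have ddab : d <= (b - a) / 8 by rewrite !ge_min lexx !orbT.
  have d0 : 0 < d by rewrite !lt_min !divr_gt0 // subr_gt0.
  exists d; split => //; first by lra.
    move=> x /andP[ax xa].
    have : `|f a - M * a - (f x - M * x)| <= e.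
      by apply: Ha => /=; rewrite ler0_norm; lra.
    by rewrite ler_norml /r /e; lra.
  move=> x /andP[bx xb].
  have : `|f b - M * b - (f x - M * x)| <= e.
    by apply: Hb => /=; rewrite ger0_norm; lra.
  by rewrite ler_norml /r /e; lra.
pose phi := spline_bump a b d.
pose dphi y := tent a d y - tent (b - d *+ 2) d y.
have := wfg phi (test_function_spline_bump d0 dab abO).
rewrite -/phi (derive1_spline_bump a b d : derive1 phi = dphi).
have out x : ~~ (a <= x <= b) -> phi x = 0 /\ dphi x = 0 by exact: spline_bump_eq0.
rewrite (@Rintegral_eq_domain _ Omega `[a, b]%classic); last first.
  move=> x; have [xab _|/out[_ ->]] := boolP (a <= x <= b); last by rewrite ?mulr0 ?eqxx.
  by split => // _; apply: abO.
rewrite [in RHS](@Rintegral_eq_domain _ Omega `[a, b]%classic); last first.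
  move=> x; have [xab _|/out[-> _]] := boolP (a <= x <= b); last by rewrite ?mulr0 ?eqxx.
  by split => // _; apply: abO.
have cphi x : {for x, continuous phi} by exact: is_derive_continuous (is_derive_spline_bump a b d x).
have cdphi : continuous dphi by move=> x; apply: cvgB; exact: continuous_tent.
move/eqP; rewrite -subr_eq0 opprK -RintegralD //; last 2 first.
- by apply: segment_integrable => x xab; apply: continuousM; [exact: cf|exact: cdphi].
- by apply: segment_integrable => x xab; apply: continuousM; [exact: cg|exact: cphi].
apply/negP; rewrite lt_eqF //.
(* A primitive of a majorant [h] of the integrand: [g] is replaced by [M], and [f] on the two ramps
   by [M y + r - e] and [M y + r + e]. As [phi] vanishes at both ends, [H b - H a = - 8 e d^2]. *)
pose H y := (M * y + r) * phi y - e * (spline_step a d y + spline_step (b - d *+ 2) d y).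
pose h y := M * phi y + (M * y + r) * dphi y - e * (tent a d y + tent (b - d *+ 2) d y).
have dH (y : R) : is_derive y 1 H (h y).
  have i1 := is_derive_spline_bump a b d y.
  have i2 := is_derive_spline_step a d y.
  have i3 := is_derive_spline_step (b - d *+ 2) d y.
  have i4 : is_derive y 1 (fun y => M * y + r) M.
    by apply: trigger_derive; rewrite /GRing.scale /=; ring.
  have i5 := is_deriveB (is_deriveM i4 i1) (is_deriveZ e (is_deriveD i2 i3)).
  apply: (is_derive_eq (f := H) i5); rewrite /h /GRing.scale /= /phi /dphi; ring.
have ch : continuous h.
  move=> y; apply: cvgB.
    apply: cvgD; first by apply: cvgM; [exact: cvg_cst | exact: cphi].
    apply: cvgM; last exact: cdphi.
    by apply: cvgD; [apply: cvgM; [exact: cvg_cst|exact: cvg_id] | exact: cvg_cst].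
  by apply: cvgM; [exact: cvg_cst | apply: cvgD; exact: continuous_tent].
apply: (@le_lt_trans _ _ (\int[leb]_(x in `[a, b]) h x)).
  apply: le_Rintegral => //.
  - apply: segment_integrable => x xab; apply: continuousD.
      by apply: continuousM; [exact: cf|exact: cdphi].
    by apply: continuousM; [exact: cg|exact: cphi].
  - by apply: segment_integrable => x xab; exact: ch.
  move=> x; rewrite /= in_itv /= => /[dup] xab /andP[ax xb].
  have p0 : 0 <= phi x by exact: spline_bump_ge0.
  have gphi : g x * phi x <= M * phi x by rewrite ler_wpM2r ?gM.
  have t1 : (f x - M * x - r + e) * tent a d x <= 0.
    have [xad|xad] := leP x (a + d *+ 2); last by rewrite tent_right ?mulr0 // ltW.
    rewrite mulr_le0_ge0 ?tent_ge0 //.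
    by have := fl x; rewrite ax xad => /(_ isT); lra.
  have t2 : 0 <= (f x - M * x - r - e) * tent (b - d *+ 2) d x.
    have [xad|xad] := leP x (b - d *+ 2); first by rewrite tent_left ?mulr0 // ltW.
    rewrite mulr_ge0 ?tent_ge0 //.
    by have := fr x; rewrite xb (ltW xad) => /(_ isT); lra.
  rewrite /h /dphi; lra.
rewrite (@Rintegral_derive _ H) //; last by move=> x _; exact: ch.
rewrite /H /phi /spline_bump.
have ad : a + d *+ 2 <= b by lra.
have bd : b - d *+ 2 + d *+ 2 <= b by lra.
have ab2 : a <= b - d *+ 2 by lra.
rewrite !(spline_step_right (ltW d0) ad) !(spline_step_right (ltW d0) bd).
rewrite !(spline_step_left (ltW d0) (lexx a)) !(spline_step_left (ltW d0) ab2).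
have : 0 < e * d ^+ 2 by rewrite mulr_gt0 // exprn_gt0.
lra.
Qed.

End WeakDerivative.

(** * Weak and classical derivatives off the origin *)

Section PuncturedLine.
Variable R : realType.
Notation leb := (@lebesgue_measure R).
Implicit Types f g : R -> R.

Section TestSupport.
Variables (phi : R -> R) (tphi : test_function (@punctured_line R) phi).

Lemma test_function_near0 : \forall x \near 0, phi x = 0 /\ derive1 phi x = 0.
Proof.
have [_ _ [K [cK KO phi0]]] := tphi.
have oK : open (~` K) by apply: closed_openC; apply: compact_closed => //; exact: Rhausdorff.
have K0 : (~` K) 0 by move=> /KO; rewrite /punctured_line /= eqxx.
have : nbhs (0 : R) (~` K) by exact: open_nbhs_nbhs.
rewrite -nbhs_nearE => /near_join; apply: filterS => x xK; split.
  by apply: phi0; exact: nbhs_singleton xK.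
rewrite derive1E (@near_eq_derive _ _ _ _ (cst 0)) ?derive_cst //.
by apply: filterS xK => y /phi0.
Qed.

Lemma test_function_bounded_support : exists2 B : R, 0 < B &
  forall x, ~~ (- B < x < B) -> phi x = 0 /\ derive1 phi x = 0.
Proof.
have [_ _ [K [cK KO phi0]]] := tphi.
have [M [_ /(_ (`|M| + 1))]] := compact_bounded cK.
rewrite (lt_le_trans (_ : M < `|M| + 1)) ?(le_lt_trans (ler_norm M)) ?ltrDl //.
move=> /(_ isT) /= KM.
have out x : `|M| + 1 < `|x| -> phi x = 0.
  by move=> Mx; apply: phi0 => /KM; rewrite leNgt Mx.
exists (`|M| + 2); first by rewrite ltr_wpDl.
move=> x; rewrite -ltr_norml -leNgt => xB.
have xM : `|M| + 1 < `|x| by apply: lt_le_trans xB; rewrite ltrD2l ltr1n.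
split; first exact: out.
rewrite derive1E (@near_eq_derive _ _ _ _ (cst 0)) ?derive_cst //.
have : \forall y \near x, `|M| + 1 < `|y|.
  exact: (cvgr_gt _ (@norm_continuous R R^o x) _ xM).
by apply: filterS => y /out.
Qed.

(** Test functions vanish near the origin, so the products are continuous there whatever f does.
    Integrals over the punctured line thus become integrals of continuous functions over a
    segment. *)
Lemma continuous_mul_test f : (forall x : R, x != 0 -> {for x, continuous f}) ->
  continuous (fun x => f x * phi x) /\ continuous (fun x => f x * derive1 phi x).
Proof.
have [dphi cphi _] := tphi => cf.
have near0 (h : R -> R) : (\forall x \near 0, h x = 0) -> {for 0, continuous h}.
  move=> h0; have E : h 0 = 0 := nbhs_singleton h0.
  by rewrite /prop_for /continuous_at E; apply: cvg_near_cst.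
split=> x; have [->|x0] := eqVneq x 0.
- by apply: near0; apply: filterS test_function_near0 => y [-> _]; rewrite mulr0.
- apply: continuousM; first exact: cf.
  exact: is_derive_continuous (derivableP (dphi x)).
- by apply: near0; apply: filterS test_function_near0 => y [_ ->]; rewrite mulr0.
- by apply: continuousM; [exact: cf | exact: cphi].
Qed.

Lemma Rintegral_mul_test f (h : R -> R) (B : R) : h = phi \/ h = derive1 phi ->
  (forall x, ~~ (- B < x < B) -> phi x = 0 /\ derive1 phi x = 0) ->
  \int[leb]_(x in @punctured_line R) (f x * h x) =
  \int[leb]_(x in `[- B, B]) (f x * h x).
Proof.
move=> hphi out; apply: Rintegral_eq_domain => x; rewrite mulf_eq0 negb_or => /andP[_ hx].
split=> [_|_].
  rewrite /= in_itv /=; apply: contraNT hx => xB.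
  have [] := out x; last by case: hphi => -> p0 p1; apply/eqP.
  by apply: contra xB => /andP[/ltW -> /ltW ->].
rewrite /punctured_line /=; apply: contraNneq hx => ->.
by have [] := nbhs_singleton test_function_near0; case: hphi => -> p0 p1; apply/eqP.
Qed.

End TestSupport.

(** [f phi] vanishes near the origin and is therefore differentiable on the whole line: one
    application of the fundamental theorem on [[- B, B]] covers both half-lines. *)
Lemma derivative_weak_derivative f g :
  (forall x : R, x != 0 -> is_derive x 1 f (g x)) ->
  (forall x : R, x != 0 -> {for x, continuous g}) ->
  weak_derivative (@punctured_line R) f g.
Proof.
move=> df cg phi tphi; have [dphi cphi _] := tphi.
have cf (x : R) : x != 0 -> {for x, continuous f} by move=> /df /is_derive_continuous.
have [B B0 out] := test_function_bounded_support tphi.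
rewrite (Rintegral_mul_test tphi _ (or_intror erefl) out).
rewrite (Rintegral_mul_test tphi _ (or_introl erefl) out).
have [_ c1] := continuous_mul_test tphi cf.
have [c2 _] := continuous_mul_test tphi cg.
apply/eqP; rewrite -subr_eq0 opprK -RintegralD //; last 2 first.
- by apply: segment_integrable => x _; exact: c1.
- by apply: segment_integrable => x _; exact: c2.
have dfp (x : R) : is_derive x 1 (fun x => f x * phi x) (f x * derive1 phi x + g x * phi x).
  have [->|x0] := eqVneq x 0.
    have n0 := test_function_near0 tphi.
    have [-> ->] := nbhs_singleton n0; rewrite !mulr0 addr0.
    apply: (@near_eq_is_derive _ _ _ (cst 0)).
    by apply: filterS n0 => y [-> _]; rewrite mulr0.
  have i1 := df x x0; have i2 := derivableP (dphi x).
  have i3 := is_deriveM i1 i2.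
  apply: (is_derive_eq i3); rewrite /GRing.scale /= derive1E; ring.
rewrite (@Rintegral_derive _ (fun x => f x * phi x)) //; last 2 first.
- by rewrite (lt_trans _ B0) // oppr_lt0.
- by move=> x _; apply: continuousD; [exact: c1 | exact: c2].
have [-> _] := out B (ltac:(by rewrite ltxx andbF)).
have [-> _] := out (- B) (ltac:(by rewrite ltxx)).
by rewrite !mulr0 subrr.
Qed.

Lemma weak_derivative_slope f g (a b M : R) : a < b -> ~~ (a <= 0 <= b) ->
  weak_derivative (@punctured_line R) f g ->
  (forall x : R, x != 0 -> {for x, continuous f}) ->
  (forall x : R, x != 0 -> {for x, continuous g}) ->
  (forall x, a <= x <= b -> g x <= M) -> f b - f a <= M * (b - a).
Proof.
move=> ab n0 w cf cg gM.
have x0 x : a <= x <= b -> x != 0 by apply: contraTneq => ->.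
apply: (weak_slope_le ab _ w) => [x /=|x /x0|x /x0|//]; last 2 first.
- exact: cf.
- exact: cg.
by rewrite in_itv /= => /x0.
Qed.

(** Near x the function g stays within e of [g x]. The mean value inequality for [(f, g)] and for
    [(- f, - g)] then encloses the difference quotients of f between [g x - e] and [g x + e]. *)
Lemma weak_derivative_derivable f g :
  weak_derivative (@punctured_line R) f g ->
  (forall x : R, x != 0 -> {for x, continuous f}) ->
  (forall x : R, x != 0 -> {for x, continuous g}) ->
  forall x : R, x != 0 -> is_derive x 1 f (g x).
Proof.
move=> w cf cg x x0.
have wN : weak_derivative (@punctured_line R) (\- f) (\- g).
  move=> phi tphi.
  have [B B0 out] := test_function_bounded_support tphi.
  have := w phi tphi.
  rewrite !(Rintegral_mul_test tphi _ (or_intror erefl) out).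
  rewrite !(Rintegral_mul_test tphi _ (or_introl erefl) out).
  have [_ c1] := continuous_mul_test tphi cf.
  have [c2 _] := continuous_mul_test tphi cg.
  have -> : (fun x => (\- f) x * derive1 phi x) = (fun x => -1 * (f x * derive1 phi x)).
    by apply/funext => y; rewrite mulN1r mulNr.
  have -> : (fun x => (\- g) x * phi x) = (fun x => -1 * (g x * phi x)).
    by apply/funext => y; rewrite mulN1r mulNr.
  move=> E; rewrite !RintegralZl ?E ?mulrN //.
  - by apply: segment_integrable => y _; exact: c2.
  - by apply: segment_integrable => y _; exact: c1.
have cfN (y : R) : y != 0 -> {for y, continuous (\- f)} by move=> /cf /continuousN.
have cgN (y : R) : y != 0 -> {for y, continuous (\- g)} by move=> /cg /continuousN.
apply: is_derive_linear_bound => e e0.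
have /cvgrPdist_le /(_ e e0) /nbhs_normP[r0 /= r00 Hr0] := cg x x0.
(* A radius at most [|x|] keeps the segment between the two points away from the origin. *)
pose r := Num.min r0 `|x|.
have r_gt0 : 0 < r by rewrite lt_min r00 normr_gt0.
have slope a b : a < b -> `|x - a| < r -> `|x - b| < r ->
    `|f b - f a - g x * (b - a)| <= e * (b - a).
  rewrite !lt_min => ab /andP[xa0 xa] /andP[xb0 xb].
  have n0 : ~~ (a <= 0 <= b).
    apply/negP => /andP[a0 b0]; move: xa xb.
    by case: (ltrgt0P x) x0 => // x0 _; rewrite !ltr_norml; lra.
  have near y : a <= y <= b -> `|g x - g y| <= e.
    move=> /andP[ay yb]; apply: Hr0 => /=.
    by move: xa0 xb0; rewrite !ltr_norml; lra.
  have u1 : f b - f a <= (g x + e) * (b - a).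
    apply: (weak_derivative_slope ab n0 w cf cg) => y /near.
    by rewrite ler_norml; lra.
  have u2 : - f b - - f a <= (- g x + e) * (b - a).
    apply: (weak_derivative_slope ab n0 wN cfN cgN) => y /near.
    by rewrite ler_norml /=; lra.
  by rewrite ler_norml; lra.
near=> y.
have xy : `|x - y| < r by near: y; apply/nbhs_normP; exists r.
have [yx|xy'|->] := ltgtP y x; last by rewrite !subrr mulr0 subrr normr0 mulr0.
  have := slope y x yx xy; rewrite subrr normr0 => /(_ r_gt0).
  rewrite -normrN (ltr0_norm (_ : y - x < 0)) ?subr_lt0 // !opprB.
  have -> : f y - f x - g x * (y - x) = g x * (x - y) + (f y - f x) by ring.
  by [].
have := slope x y xy' ; rewrite subrr normr0 => /(_ r_gt0 xy).
by rewrite (gtr0_norm (_ : 0 < y - x)) // subr_gt0.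
Unshelve. all: by end_near. Qed.

End PuncturedLine.

(** * Hyperbolic functions and the soliton *)

Section Hyperbolic.
Variable R : realType.
Implicit Types x y : R.

Lemma cosh_gt0 x : 0 < cosh x.
Proof. by rewrite divr_gt0 // addr_gt0 ?expR_gt0. Qed.

Lemma cosh_ge_expR x : expR `|x| / 2 <= cosh x.
Proof.
rewrite ler_pM2r //; have [x0|x0] := ger0P x; first by rewrite lerDl expR_ge0.
by rewrite lerDr expR_ge0.
Qed.

Lemma sqr_tanh x : 1 - tanh x ^+ 2 = (cosh x ^+ 2)^-1.
Proof.
have e := expRxMexpNx_1 x; have p := cosh_gt0 x.
have n0 : expR x + expR (- x) != 0 by rewrite gt_eqF // addr_gt0 ?expR_gt0.
rewrite /tanh /cosh; field: e; rewrite ?n0 //.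
Qed.

Lemma norm_tanh_lt1 x : `|tanh x| < 1.
Proof.
rewrite -[X in _ < X]/(1 : R) -sqr_ltE // expr1n sqr_tanh invr_gt0 exprn_gt0 //.
exact: cosh_gt0.
Qed.

Lemma is_derive_expR_opp x : is_derive x 1 (fun x : R => expR (- x)) (- expR (- x)).
Proof.
have h1 := is_derive_expR (- x).
have h2 : is_derive x 1 (fun x : R => - x) (-1) by apply: trigger_derive.
have := @is_derive1_comp R expR (fun x => - x) x _ _ h1 h2.
by rewrite mulrN1.
Qed.

Lemma is_derive_cosh x : is_derive x 1 (@cosh R) (tanh x * cosh x).
Proof.
have n0 : expR x + expR (- x) != 0 by rewrite gt_eqF // addr_gt0 ?expR_gt0.
have h1 := is_derive_expR x; have h2 := is_derive_expR_opp x.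
have E : @cosh R = 2^-1 *: (expR + (fun x : R => expR (- x))).
  by apply/funext => y; rewrite /cosh !fctE /GRing.scale /= mulrC.
rewrite [X in is_derive _ _ X _]E.
apply: trigger_derive; rewrite /GRing.scale /= /tanh /cosh; field.
exact: n0.
Qed.

Lemma is_derive_tanh x : is_derive x 1 (@tanh R) (1 - tanh x ^+ 2).
Proof.
have n0 : expR x + expR (- x) != 0 by rewrite gt_eqF // addr_gt0 ?expR_gt0.
have h1 := is_derive_expR x; have h2 := is_derive_expR_opp x.
have h3 := is_deriveD h1 h2.
have h4 := is_deriveB h1 h2.
have h5 := @is_deriveV R (expR + (fun x : R => expR (- x))) x _ 1 n0 h3.
have h6 := is_deriveM h4 h5.
apply: (is_derive_eq (f := @tanh R) h6).
rewrite /GRing.scale /= /tanh !fctE; field.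
exact: n0.
Qed.

Definition artanh y : R := ln ((1 + y) / (1 - y)) / 2.

Lemma artanhK y : `|y| < 1 -> tanh (artanh y) = y.
Proof.
rewrite ltr_norml => /andP[y1 y2].
have p1 : 0 < 1 + y by lra.
have p2 : 0 < 1 - y by lra.
have p : 0 < (1 + y) / (1 - y) by rewrite divr_gt0.
have e0 := expR_gt0 (artanh y).
have e2 : expR (artanh y) ^+ 2 = (1 + y) / (1 - y).
  by rewrite expr2 -expRD /artanh -splitr lnK.
rewrite /tanh expRN.
have -> : (expR (artanh y) - (expR (artanh y))^-1) / (expR (artanh y) + (expR (artanh y))^-1)
   = (expR (artanh y) ^+ 2 - 1) / (expR (artanh y) ^+ 2 + 1).
  by field; rewrite !gt_eqF //; nra.
by rewrite e2; field; rewrite !gt_eqF //; lra.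
Qed.

Lemma tanhK x : artanh (tanh x) = x.
Proof.
have e0 := expR_gt0 x; have e1 := expR_gt0 (- x).
have -> : artanh (tanh x) = ln (expR x ^+ 2) / 2.
  congr (ln _ / 2); rewrite /tanh expRN; field.
  by apply/and3P; split; apply: lt0r_neq0; nra.
by rewrite expr2 -expRD expRK; field.
Qed.

Lemma is_derive_artanh y : `|y| < 1 -> is_derive y 1 artanh (1 - y ^+ 2)^-1.
Proof.
rewrite ltr_norml => /andP[y1 y2].
have p1 : 0 < 1 + y by lra.
have p2 : 0 < 1 - y by lra.
have h1 : is_derive y 1 (fun y : R => 1 + y) 1.
  by apply: trigger_derive; ring.
have h2 : is_derive y 1 (fun y : R => 1 - y) (-1).
  by apply: trigger_derive; ring.
have h3 := @is_derive1_comp R (@ln R) (fun y => 1 + y) y _ _ (is_derive1_ln p1) h1.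
have h4 := @is_derive1_comp R (@ln R) (fun y => 1 - y) y _ _ (is_derive1_ln p2) h2.
have h5 := is_deriveZ 2^-1 (is_deriveB h3 h4).
apply: (@near_eq_is_derive _ _ _ (2^-1 *: ((@ln R \o (fun y => 1 + y)) - (@ln R \o (fun y => 1 - y))))).
  near=> z; rewrite /artanh !fctE /GRing.scale /= ln_div ?posrE 1?mulrC //.
    have : -1 < z by near: z; exact: lt_nbhsr.
    by lra.
  have : z < 1 by near: z; exact: lt_nbhsl.
  by lra.
apply: (is_derive_eq h5); rewrite /GRing.scale /=; field.
by rewrite !gt_eqF //; nra.
Unshelve. all: by end_near. Qed.

End Hyperbolic.

(** * The soliton: its equation, characterization and decay *)

Section Soliton.
Variables (R : realType) (mu omega : R).
Hypotheses (mu0 : 0 < mu) (omega0 : 0 < omega).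
Implicit Types x : R.
Notation k := (Num.sqrt omega).

Lemma is_derive_comp_scale (f : R -> R) (c x d : R) :
  is_derive (c * x) 1 f d -> is_derive x 1 (fun x => f (c * x)) (c * d).
Proof.
move=> h1; have h2 : is_derive x 1 (fun x : R => c * x) c.
  by apply: trigger_derive; rewrite /GRing.scale /=; ring.
by have := @is_derive1_comp R f (fun x => c * x) x _ _ h1 h2; rewrite mulrC.
Qed.

Lemma is_derive_T_of x :
  is_derive x 1 (T_of mu omega) (mu * k * (1 - T_of mu omega x ^+ 2)).
Proof. exact/is_derive_comp_scale/is_derive_tanh. Qed.

Lemma soliton_gt0 x : 0 < soliton mu omega x.
Proof.
by rewrite mulr_gt0 // powR_gt0 ?cosh_gt0 // mulr_gt0 // addr_gt0.
Qed.

Lemma is_derive_soliton x :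
  is_derive x 1 (soliton mu omega) (- k * T_of mu omega x * soliton mu omega x).
Proof.
have h1 := is_derive_comp_scale (is_derive_cosh (mu * k * x)).
have h2 := @is_derive1_powR R (- mu^-1) _ (cosh_gt0 (mu * k * x)).
have h3 := @is_derive1_comp R (fun y => y `^ (- mu^-1)) (fun x => cosh (mu * k * x)) x _ _ h2 h1.
have h4 := is_deriveZ ((omega * (mu + 1)) `^ (2 * mu)^-1) h3.
apply: (is_derive_eq (f := soliton mu omega) h4).
rewrite /GRing.scale /= /soliton /T_of -/(cosh _) powRB; last first.
  by rewrite (gt_eqF (cosh_gt0 _)) implybT.
rewrite powRr1 ?ltW ?cosh_gt0 //; field.
by rewrite !gt_eqF ?cosh_gt0.
Qed.

(** The zero-energy identity of the soliton. Through it, relations between soliton values become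
    algebraic relations between values of T. *)
Lemma soliton_powR x :
  soliton mu omega x `^ (2 * mu) = omega * (mu + 1) * (1 - T_of mu omega x ^+ 2).
Proof.
have c0 := cosh_gt0 (mu * k * x).
rewrite powRM ?powR_ge0 // -!powRrM mulVf; last by rewrite gt_eqF ?mulr_gt0.
rewrite powRr1; last by rewrite ltW // mulr_gt0 // addr_gt0.
congr (_ * _); rewrite sqr_tanh.
have -> : - mu^-1 * (2 * mu) = - 2%:R by field; rewrite gt_eqF.
by rewrite powR_invn // ltW.
Qed.

Lemma soliton_unique (r x : R) : 0 < r ->
  r `^ (2 * mu) = omega * (mu + 1) * (1 - T_of mu omega x ^+ 2) ->
  r = soliton mu omega x.
Proof.
move=> r0; rewrite -soliton_powR.
apply: powR_injective; rewrite ?nnegrE ?ltW ?soliton_gt0 ?mulr_gt0 //.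
Qed.

Lemma is_derive_soliton2 x :
  is_derive x 1 (fun x => - k * T_of mu omega x * soliton mu omega x)
    ((omega - soliton mu omega x `^ (2 * mu)) * soliton mu omega x).
Proof.
have h1 := is_derive_T_of x; have h2 := is_derive_soliton x.
have h3 := is_deriveM (is_deriveZ (- k) h1) h2.
apply: (is_derive_eq h3).
have kk : k ^+ 2 = omega by rewrite sqr_sqrtr // ltW.
rewrite soliton_powR /GRing.scale /= /GRing.scale /=; ring: kk.
Qed.

(** Raise [cosh y >= exp |y| / 2] to the power [- 1 / mu]; the factor 2 contributes the power of 2
    in the constant. *)
Lemma soliton_decay : exists C : R,
  forall x, soliton mu omega x <= C * expR (- k * `|x|).
Proof.
exists ((omega * (mu + 1)) `^ (2 * mu)^-1 * 2 `^ mu^-1) => x.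
rewrite -mulrA ler_wpM2l ?powR_ge0 //.
have -> : expR (- k * `|x|) = (expR `|mu * k * x|) `^ (- mu^-1).
  rewrite /powR gt_eqF ?expR_gt0 // expRK; congr expR.
  by rewrite !normrM (gtr0_norm mu0) ger0_norm ?sqrtr_ge0 //; field; rewrite gt_eqF.
rewrite !powRN ler_pdivlMr ?powR_gt0 ?expR_gt0 // mulrC.
rewrite ler_pdivrMr ?powR_gt0 ?cosh_gt0 // -powRM ?(ltW (cosh_gt0 _)) //.
apply: ge0_ler_powR; rewrite ?nnegrE ?expR_ge0 ?invr_ge0 ?(ltW mu0) //.
  by rewrite mulr_ge0 // ltW ?cosh_gt0.
by rewrite -ler_pdivrMl // mulrC cosh_ge_expR.
Qed.

End Soliton.

Lemma solitonN (R : realType) (mu omega x : R) :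
  soliton mu omega (- x) = soliton mu omega x.
Proof. by rewrite /soliton mulrN /cosh opprK [expR (- _) + _]addrC. Qed.

(* Otherwise rewriting with lemmas about products unfolds [soliton]. *)
#[global] Opaque soliton.

(** * Solutions of the equation on a half-line *)

Section HalfLine.
Variables (R : realType) (mu omega : R) (p q p1 q1 : R -> R).
Hypothesis mu0 : 0 < mu.
Implicit Types x : R.
(** For u = p + i q: [N] is |u|^2, [N1] is |u'|^2 and [D] is half the derivative of [N]. *)
Let N x := p x ^+ 2 + q x ^+ 2.
Let N1 x := p1 x ^+ 2 + q1 x ^+ 2.
Let D x := p x * p1 x + q x * q1 x.
Hypothesis dp : forall x, 0 < x -> is_derive x 1 p (p1 x).
Hypothesis dq : forall x, 0 < x -> is_derive x 1 q (q1 x).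
Hypothesis dp1 : forall x, 0 < x -> is_derive x 1 p1 ((omega - N x `^ mu) * p x).
Hypothesis dq1 : forall x, 0 < x -> is_derive x 1 q1 ((omega - N x `^ mu) * q x).
(** Integrability gives small values but not directly a limit at infinity. The quantities it is
    applied to are constant, so a single small value suffices for each e. *)
Hypothesis small : forall e, 0 < e -> exists2 x, 0 < x & N x + N1 x < e.

Let N_ge0 x : 0 <= N x. Proof. by rewrite addr_ge0 ?sqr_ge0. Qed.
Let N1_ge0 x : 0 <= N1 x. Proof. by rewrite addr_ge0 ?sqr_ge0. Qed.

Let half_line_constant (g : R -> R) : (forall x, 0 < x -> is_derive x 1 g 0) ->
  forall x y, 0 < x -> 0 < y -> g x = g y.
Proof.
move=> dg x y x0 y0; have [xy|/ltW yx] := leP x y; [|apply: esym];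
  apply: zero_derive_constant => // z /andP[h _]; apply: dg; exact: lt_le_trans h.
Qed.

(* Square integrability makes every conserved quantity vanish. *)
Let conserved_eq0 (g : R -> R) (C : R) : (forall x, 0 < x -> is_derive x 1 g 0) ->
  (forall x, 0 < x -> N x + N1 x < 1 -> `|g x| <= C * (N x + N1 x)) ->
  forall x, 0 < x -> g x = 0.
Proof.
move=> dg gC x x0; apply/eqP; rewrite -normr_le0; apply/ler_addgt0Pr => e e0.
rewrite add0r.
have C1 : 0 < `|C| + 1 by rewrite ltr_wpDl.
have [|y y0] := small (e := Num.min 1 (e / (`|C| + 1))).
  by rewrite lt_min ltr01 divr_gt0.
rewrite lt_min => /andP[y1 ye]; rewrite (half_line_constant dg x0 y0).
apply: le_trans (gC y y0 y1) _.
apply: (@le_trans _ _ ((`|C| + 1) * (N y + N1 y))).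
  apply: ler_wpM2r; first exact: addr_ge0 (N_ge0 y) (N1_ge0 y).
  by rewrite (le_trans (ler_norm C)) // lerDl.
by rewrite mulrC -ler_pdivlMr // ltW.
Qed.

Let dN x : 0 < x -> is_derive x 1 N (2 * D x).
Proof.
move=> x0; have h1 := dp x0; have h2 := dq x0.
have h3 := is_deriveD (is_deriveM h1 h1) (is_deriveM h2 h2).
apply: (is_derive_eq (f := N) h3).
by rewrite /GRing.scale /= /D; ring.
Qed.

(** Conserved because u'' is a real multiple of u; being quadratic in (u, u'), it is at most
    [N + N1]. *)
Lemma angular_momentum_eq0 x : 0 < x -> p x * q1 x - q x * p1 x = 0.
Proof.
apply: (@conserved_eq0 (fun x => p x * q1 x - q x * p1 x) 1) => {}x x0.
  have h1 := dp x0; have h2 := dq x0; have h3 := dp1 x0; have h4 := dq1 x0.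
  have h5 := is_deriveB (is_deriveM h1 h4) (is_deriveM h2 h3).
  by apply: (is_derive_eq h5); rewrite /GRing.scale /=; ring.
move=> _; rewrite mul1r ler_norml /N /N1.
have := sqr_ge0 (p x + q1 x); have := sqr_ge0 (q x - p1 x).
have := sqr_ge0 (p x - q1 x); have := sqr_ge0 (q x + p1 x).
have := sqr_ge0 (p x); have := sqr_ge0 (q x); have := sqr_ge0 (p1 x); have := sqr_ge0 (q1 x).
nra.
Qed.

(** The potential is written [N * N^mu] so that it can be differentiated at zeros of [N]. Where
    [N + N1 < 1] one has [N^mu <= 1], which makes the energy linearly bounded by [N + N1]. *)
Lemma energy_eq0 x : 0 < x ->
  N1 x - omega * N x + (mu + 1)^-1 * (N x * N x `^ mu) = 0.
Proof.
have m1 : 0 < mu + 1 by rewrite addr_gt0.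
apply: (@conserved_eq0 (fun x => N1 x - omega * N x + (mu + 1)^-1 * (N x * N x `^ mu))
  (1 + `|omega| + (mu + 1)^-1)) => {}x x0.
  have h1 := dp1 x0; have h2 := dq1 x0; have h3 := dN x0.
  have h4 := is_deriveD (is_deriveM h1 h1) (is_deriveM h2 h2).
  have h5 := @is_derive1_comp R (fun t => t * `|t| `^ mu) N x _ _
     (is_derive_mul_powR_norm (N x) mu0) h3.
  have h6 := is_deriveD (is_deriveB h4 (is_deriveZ omega h3)) (is_deriveZ (mu + 1)^-1 h5).
  have E : (fun x => N1 x - omega * N x + (mu + 1)^-1 * (N x * N x `^ mu)) =
      (p1 * p1 + q1 * q1) - omega *: N
      + (mu + 1)^-1 *: ((fun t => t * `|t| `^ mu) \o N).
    by apply/funext => y; rewrite !fctE /GRing.scale /= (ger0_norm (N_ge0 y)) /N1 !expr2.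
  rewrite [X in is_derive _ _ X _]E.
  apply: (is_derive_eq h6); rewrite /GRing.scale /= ger0_norm ?N_ge0 // /D.
  by field; rewrite gt_eqF.
move=> small1; have n0 := N_ge0 x; have n1 := N1_ge0 x.
have Nmu : N x `^ mu <= 1.
  apply: (@le_trans _ _ (1 `^ mu)); last by rewrite powR1.
  by apply: ge0_ler_powR; rewrite ?nnegrE //; [exact: ltW | lra].
have Nm0 := powR_ge0 (N x) mu.
have v0 : 0 < (mu + 1)^-1 by rewrite invr_gt0.
apply: le_trans (ler_normD _ _) _.
apply: le_trans (lerD (ler_normB _ _) (lexx _)) _.
rewrite !normrM (ger0_norm n0) (ger0_norm n1) (ger0_norm Nm0) (gtr0_norm v0).
have a1 : `|omega| * N x <= `|omega| * (N x + N1 x) by rewrite ler_wpM2l // lerDl.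
have a2 : (mu + 1)^-1 * (N x * N x `^ mu) <= (mu + 1)^-1 * (N x + N1 x).
  rewrite ler_wpM2l ?(ltW v0) // (@le_trans _ _ (N x)) ?lerDl // -[leRHS]mulr1.
  by rewrite ler_wpM2l.
lra.
Qed.

(** When [omega <= 0] the energy is a sum of three nonnegative terms, so each of them vanishes. *)
Lemma nonpositive_frequency_eq0 x : omega <= 0 -> 0 < x -> N x = 0.
Proof.
move=> om0 x0; have := energy_eq0 x0.
have n0 := N_ge0 x; have n1 := N1_ge0 x.
have : 0 < (mu + 1)^-1 by rewrite invr_gt0 addr_gt0.
have [//|Nx] := eqVneq (N x) 0.
have Np : 0 < N x by rewrite lt_neqAle eq_sym Nx.
move=> m1 E; have : 0 < (mu + 1)^-1 * (N x * N x `^ mu) by rewrite !mulr_gt0 ?powR_gt0.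
have : 0 <= - omega * N x by rewrite mulr_ge0 // oppr_ge0.
lra.
Qed.

Lemma half_line_zero_derivative x : 0 < x -> N x = 0 -> p1 x = 0 /\ q1 x = 0.
Proof.
move=> x0 Nx; have := energy_eq0 x0; rewrite Nx mulr0 mul0r mulr0 subr0 addr0.
move=> /eqP; rewrite paddr_eq0 ?sqr_ge0 // !sqrf_eq0.
by move=> /andP[/eqP -> /eqP ->].
Qed.

Section PositiveFrequency.
Hypothesis omega0 : 0 < omega.
Notation k := (Num.sqrt omega).

Let k0 : 0 < k. Proof. by rewrite sqrtr_gt0. Qed.
Let kk : k ^+ 2 = omega. Proof. by rewrite sqr_sqrtr // ltW. Qed.

(** Lagrange's identity: [N * N1] is the square of [D] plus the square of the angular momentum. *)
Let sqr_D x : 0 < x -> D x ^+ 2 = N x * N1 x.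
Proof.
move=> x0; have L := angular_momentum_eq0 x0.
transitivity (N x * N1 x - (p x * q1 x - q x * p1 x) ^+ 2).
  by rewrite /D /N /N1; ring.
by rewrite L expr0n subr0.
Qed.

Let norm_D_le x : 0 < x -> `|D x| <= k * N x.
Proof.
move=> x0; rewrite -(@ler_pXn2r _ 2) ?nnegrE ?mulr_ge0 ?N_ge0 ?(ltW k0) //.
rewrite real_normK ?num_real // sqr_D // exprMn kk.
have := energy_eq0 x0; have n0 := N_ge0 x.
have : 0 <= (mu + 1)^-1 * (N x * N x `^ mu).
  by rewrite !mulr_ge0 ?powR_ge0 // invr_ge0 ltW // addr_gt0.
move=> h E; have : N1 x <= omega * N x by lra.
by move=> h1; rewrite expr2 mulrCA; rewrite ler_wpM2l.
Qed.

(* |N'| <= 2 k N, so N cannot decay faster than an exponential. *)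
Lemma sqr_modulus_lower_bound x y : 0 < x -> 0 < y ->
  N x * expR (- (2 * k * `|y - x|)) <= N y.
Proof.
have dexp (c z : R) : is_derive z 1 (fun z => expR (c * z)) (c * expR (c * z)).
  by apply: is_derive_comp_scale.
move=> x0 y0; have [xy|/ltW yx] := leP x y.
  rewrite ger0_norm ?subr_ge0 //.
  have := @nonneg_derive_le R (fun z => N z * expR (2 * k * z))
    (fun z => (2 * D z + 2 * k * N z) * expR (2 * k * z)) x y xy.
  have -> : - (2 * k * (y - x)) = 2 * k * x + - (2 * k * y) by ring.
  rewrite expRD mulrA expRN ler_pdivrMr ?expR_gt0 //; apply => z /andP[xz _].
    have z0 := lt_le_trans x0 xz.
    have h1 := dN z0; have h2 := dexp (2 * k) z.
    have h3 := is_deriveM h1 h2.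
    by apply: (is_derive_eq h3); rewrite /GRing.scale /=; ring.
  have z0 := lt_le_trans x0 xz.
  rewrite mulr_ge0 ?expR_ge0 //.
  by have := norm_D_le z0; rewrite ler_norml; lra.
rewrite ler0_norm ?subr_le0 //.
have := @nonneg_derive_le R (fun z => - (N z * expR (- (2 * k) * z)))
    (fun z => - ((2 * D z - 2 * k * N z) * expR (- (2 * k) * z))) y x yx.
have -> : - (2 * k * - (y - x)) = - (2 * k) * x - (- (2 * k) * y) by ring.
rewrite expRD mulrA expRN ler_pdivrMr ?expR_gt0 // lerN2; apply => z /andP[yz _].
  have z0 := lt_le_trans y0 yz.
  have h1 := dN z0; have h2 := dexp (- (2 * k)) z.
  have h3 := is_deriveN (is_deriveM h1 h2).
  by apply: (is_derive_eq h3); rewrite /GRing.scale /=; ring.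
have z0 := lt_le_trans y0 yz.
rewrite -mulNr mulr_ge0 ?expR_ge0 //.
by have := norm_D_le z0; rewrite ler_norml; lra.
Qed.

Section NonZero.
Hypothesis N_gt0 : forall x, 0 < x -> 0 < N x.

(** Since [N' = 2 D], this is minus the logarithmic derivative of |u| divided by [k], without a
    square root to differentiate. *)
Let T x := - D x / (k * N x).

(** The zero-energy relation divided by N, with [D^2 = N * N1]. Positivity of the left side is what
    confines T to the range of tanh. *)
Let sqr_T x : 0 < x -> N x `^ mu = omega * (mu + 1) * (1 - T x ^+ 2).
Proof.
move=> x0; have n0 := N_gt0 x0; have E := energy_eq0 x0.
have E1 : N1 x = omega * N x - (mu + 1)^-1 * (N x * N x `^ mu) by lra.
rewrite /T expr_div_n sqrrN sqr_D // E1 exprMn kk; field.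
by rewrite !gt_eqF // addr_gt0.
Qed.

Let norm_T_lt1 x : 0 < x -> `|T x| < 1.
Proof.
move=> x0; rewrite -sqr_ltE // expr1n.
have : 0 < omega * (mu + 1) * (1 - T x ^+ 2) by rewrite -sqr_T // powR_gt0 // N_gt0.
by rewrite pmulr_rgt0 // mulr_gt0 // addr_gt0.
Qed.

Let dT x : 0 < x -> is_derive x 1 T (mu * k * (1 - T x ^+ 2)).
Proof.
move=> x0; have n0 := N_gt0 x0.
have h1 := dp x0; have h2 := dq x0; have h3 := dp1 x0; have h4 := dq1 x0.
have hN := dN x0.
have kN0 : k * N x != 0 by rewrite mulf_neq0 ?gt_eqF.
have hD := is_deriveN (is_deriveD (is_deriveM h1 h3) (is_deriveM h2 h4)).
have hD' : is_derive x 1 (fun x => - D x) (- (N1 x + (omega - N x `^ mu) * N x)).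
  apply: (is_derive_eq (f := fun x => - D x) hD); rewrite /GRing.scale /= /N1.
  by set w := omega - _; rewrite /N; ring.
have hV := @is_deriveV R (fun x => k * N x) x _ 1 kN0 (is_deriveZ k hN).
have h5 := is_deriveM hD' hV.
apply: (is_derive_eq (f := T) h5).
have E := energy_eq0 x0; have S := sqr_D x0; have TT := sqr_T x0.
have E1 : N1 x = omega * N x - (mu + 1)^-1 * (N x * N x `^ mu) by lra.
have -> : 1 - T x ^+ 2 = N x `^ mu / (omega * (mu + 1)).
  by rewrite TT; field; rewrite !gt_eqF // addr_gt0.
rewrite /GRing.scale /=.
transitivity ((2 * D x ^+ 2 - N x * (N1 x + (omega - N x `^ mu) * N x)) / (k * N x ^+ 2)).
  by field; rewrite !gt_eqF.
rewrite S E1; field: kk.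
by rewrite !gt_eqF // addr_gt0.
Qed.

Lemma soliton_profile : exists x0 c d : R, c ^+ 2 + d ^+ 2 = 1 /\
  forall x, 0 < x ->
    [/\ p x = c * soliton mu omega (x + x0), q x = d * soliton mu omega (x + x0),
        p1 x = - k * T_of mu omega (x + x0) * p x &
        q1 x = - k * T_of mu omega (x + x0) * q x].
Proof.
have mk0 : 0 < mu * k by rewrite mulr_gt0.
(* Chosen so that T and the translate of tanh agree at the reference point 1. *)
pose x0 := artanh (T 1) / (mu * k) - 1.
have Tx x : 0 < x -> T x = T_of mu omega (x + x0).
  move=> xp.
  (* artanh straightens the equation of T: its composite with T has constant slope [mu * k]. *)
  have : artanh (T x) - mu * k * x = artanh (T 1) - mu * k * 1.
    apply: (@half_line_constant (fun x => artanh (T x) - mu * k * x)) => // {xp}x xp.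
    have h1 := is_derive_artanh (norm_T_lt1 xp).
    have h2 := @is_derive1_comp R (@artanh R) T x _ _ h1 (dT xp).
    have h3 := is_deriveB h2 (is_deriveZ (mu * k) (is_derive_id x 1)).
    apply: (is_derive_eq h3); rewrite /GRing.scale /=; field.
    have := norm_T_lt1 xp; rewrite -sqr_ltE // expr1n => h.
    by rewrite gt_eqF.
  move=> E; rewrite -[LHS]artanhK ?norm_T_lt1 // /T_of; congr tanh.
  rewrite /x0; move/eqP: E; rewrite subr_eq => /eqP ->; field.
  by rewrite !gt_eqF.
pose S x := soliton mu omega (x + x0).
have NS x : 0 < x -> N x = S x ^+ 2.
  move=> xp; rewrite -(@sqr_sqrtr _ (N x)) //; congr (_ ^+ 2).
  apply: soliton_unique => //; first by rewrite sqrtr_gt0 N_gt0.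
  rewrite powRrM powR_mulrn ?sqrtr_ge0 // sqr_sqrtr // -Tx //.
  exact: sqr_T.
have S0 x : 0 < S x by exact: soliton_gt0.
have dS x : is_derive x 1 S (- k * T_of mu omega (x + x0) * S x).
  have h1 := is_derive_soliton omega mu0 (x + x0).
  have h2 : is_derive x 1 (fun x : R => x + x0) 1.
    by apply: trigger_derive; rewrite addr0.
  by have := @is_derive1_comp R _ (fun x => x + x0) x _ _ h1 h2; rewrite mulr1.
have kT x : 0 < x -> - k * T x = D x / N x.
  move=> xp; rewrite /T; field.
  by rewrite !gt_eqF // N_gt0.
have p1E x : 0 < x -> p1 x = - k * T_of mu omega (x + x0) * p x.
  move=> xp; rewrite -Tx // kT //; have n0 := N_gt0 xp.
  apply: (mulIf (lt0r_neq0 n0)); rewrite mulrAC divfK ?gt_eqF //.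
  apply/eqP; rewrite -subr_eq0; apply/eqP.
  (* [N p' - D p] is a multiple of the angular momentum. *)
  transitivity (- q x * (p x * q1 x - q x * p1 x)); first by rewrite /D /N; ring.
  by rewrite angular_momentum_eq0 // mulr0.
have q1E x : 0 < x -> q1 x = - k * T_of mu omega (x + x0) * q x.
  move=> xp; rewrite -Tx // kT //; have n0 := N_gt0 xp.
  apply: (mulIf (lt0r_neq0 n0)); rewrite mulrAC divfK ?gt_eqF //.
  apply/eqP; rewrite -subr_eq0; apply/eqP.
  transitivity (p x * (p x * q1 x - q x * p1 x)); first by rewrite /D /N; ring.
  by rewrite angular_momentum_eq0 // mulr0.
(* p, q and S solve the same first-order linear equation, so [p / S] and [q / S] are constant: this
   is the constancy of the phase. *)
have ratio (f f1 : R -> R) : (forall x, 0 < x -> is_derive x 1 f (f1 x)) ->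
    (forall x, 0 < x -> f1 x = - k * T_of mu omega (x + x0) * f x) ->
    forall x, 0 < x -> f x = f 1 / S 1 * S x.
  move=> df f1E x xp.
  rewrite -(half_line_constant (g := fun x => f x / S x) _ xp ltr01) ?divfK ?gt_eqF //.
  move=> {xp}x xp.
  have Sn : S x != 0 by rewrite gt_eqF.
  have h1 := is_deriveM (df x xp) (@is_deriveV R S x _ 1 Sn (dS x)).
  apply: (is_derive_eq h1); rewrite f1E // /GRing.scale /=; field.
  exact: Sn.
exists x0, (p 1 / S 1), (q 1 / S 1); split.
  rewrite !expr_div_n -mulrDl -/(N 1) NS // divff // sqrf_eq0 gt_eqF //.
move=> x xp; split; [exact: ratio dp p1E x xp|exact: ratio dq q1E x xp|exact: p1E|exact: q1E].
Qed.

End NonZero.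
End PositiveFrequency.
(** Zero amplitude must be allowed: a solution could a priori vanish on one half-line, and only the
    vertex conditions exclude this. *)
Lemma half_line_classification : exists x0 c d : R,
  (c = 0 /\ d = 0 \/ 0 < omega /\ c ^+ 2 + d ^+ 2 = 1) /\
  forall x, 0 < x ->
    [/\ p x = c * soliton mu omega (x + x0), q x = d * soliton mu omega (x + x0),
        p1 x = - Num.sqrt omega * T_of mu omega (x + x0) * p x &
        q1 x = - Num.sqrt omega * T_of mu omega (x + x0) * q x].
Proof.
have [[x xp Nx]|none] := pselect (exists2 x, 0 < x & 0 < N x).
  have om0 : 0 < omega.
    rewrite ltNge; apply/negP => om0.
    by move: Nx; rewrite (nonpositive_frequency_eq0 om0 xp) ltxx.
  (* One positive value propagates to the whole half-line, which justifies dividing by N. *)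
  have N_gt0 y : 0 < y -> 0 < N y.
    move=> yp; apply: lt_le_trans (sqr_modulus_lower_bound om0 xp yp).
    by rewrite mulr_gt0 ?expR_gt0.
  have [x0 [c [d [cd H]]]] := soliton_profile om0 N_gt0.
  by exists x0, c, d; split => //; right.
exists 0, 0, 0; split; first by left.
move=> x xp.
have Nx : N x = 0.
  apply/eqP; rewrite eq_le N_ge0 andbT leNgt; apply/negP => Nx.
  by apply: none; exists x.
have [-> ->] := half_line_zero_derivative xp Nx.
move: Nx; rewrite /N => /eqP; rewrite paddr_eq0 ?sqr_ge0 // !sqrf_eq0.
by move=> /andP[/eqP -> /eqP ->]; rewrite !mul0r !mulr0.
Qed.

End HalfLine.

(** * Square integrability *)

Section SquareIntegrable.
Variable R : realType.
Notation leb := (@lebesgue_measure R).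

(** By symmetry it suffices to integrate over the positive half-line, where the function is [k^-1]
    times the exponential density. *)
Lemma integrable_expR_norm (k : R) : 0 < k ->
  leb.-integrable setT (EFin \o (fun x => expR (- k * `|x|))).
Proof.
move=> k0.
have ce : continuous (fun x : R => expR (- k * `|x|)).
  move=> x; apply: (@continuous_comp _ _ _ (fun x : R => - k * `|x|) expR).
    by apply: continuousM; [exact: cvg_cst | exact: norm_continuous].
  exact: continuous_expR.
have me : measurable_fun setT (fun x : R => expR (- k * `|x|)) by exact: continuous_measurable_fun.
apply/integrableP; split; first exact/measurable_EFinP.
under eq_integral do rewrite /= ger0_norm ?expR_ge0 //.
rewrite ge0_symfun_integralT //; last first.
- by move=> x /=; rewrite normrN.
have mD : measurable [set x : R | 0 <= x] by rewrite -set_itvcy.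
apply: lte_mul_pinfty => //.
have i1 : leb.-integrable [set x : R | 0 <= x] (EFin \o exponential_pdf k).
  apply: integrableS (integrable_exponential_pdf k0) => //.
have i2 : leb.-integrable [set x : R | 0 <= x] (fun x => (k^-1)%:E * (EFin \o exponential_pdf k) x)%E.
  exact: integrableZl.
have /integrableP[_] := i2; apply: le_lt_trans.
rewrite le_eqVlt; apply/orP; left; apply/eqP; apply: eq_integral => x.
rewrite inE /= => x0; rewrite exponential_pdfE // mulrA mulVf ?gt_eqF // mul1r.
by rewrite !ger0_norm ?expR_ge0.
Qed.

Lemma measurable_continuous_off0 (f : R -> R) :
  (forall x, x != 0 -> {for x, continuous f}) -> measurable_fun setT f.
Proof.
move=> cf; have -> : setT = [set x : R | x != 0] `|` [set 0].
  apply/seteqP; split => x //= _; have [->|x0] := eqVneq x 0; [by right | by left].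
have o0 : open [set x : R | x != 0] by exact: open_neq.
apply/measurable_funU => //; first exact: open_measurable.
split; last exact: measurable_fun_set1.
apply: open_continuous_measurable_fun => // x; rewrite inE; exact: cf.
Qed.

Lemma Lfun2_of_decay (f : R -> R) (C k : R) : 0 < k ->
  (forall x, x != 0 -> {for x, continuous f}) ->
  (forall x, x != 0 -> `|f x| <= C * expR (- k * `|x|)) ->
  f \in Lfun leb 2%:E.
Proof.
move=> k0 cf fC.
have mf := measurable_continuous_off0 cf.
(* The decay hypothesis says nothing at the origin, so the constant must also dominate the value
   there. *)
pose B := Num.max C `|f 0|.
have fB x : `|f x| <= B * expR (- k * `|x|).
  have [->|x0] := eqVneq x 0.
    by rewrite normr0 mulr0 expR0 mulr1 le_max lexx orbT.
  by apply: le_trans (fC x x0) _; rewrite ler_pM2r ?expR_gt0 // le_max lexx.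
rewrite inE; apply/andP; split; rewrite inE //=.
rewrite /finite_norm unlock; apply: poweR_lty.
have k20 : 0 < 2 * k by rewrite mulr_gt0.
have i2 : leb.-integrable setT
    (fun x => (B ^+ 2)%:E * (EFin \o (fun x : R => expR (- (2 * k) * `|x|))) x)%E.
  by apply: integrableZl => //; exact: integrable_expR_norm.
have /integrableP[m2] := i2; apply: le_lt_trans; apply: ge0_le_integral => //.
- by move=> x _; exact: poweR_ge0.
- apply: (measurableT_comp (measurable_poweR _)) => //.
  apply: measurableT_comp => //; exact/measurable_EFinP.
- exact: measurableT_comp.
move=> x _ /=; rewrite lee_fin powR_mulrn // [leRHS]ger0_norm; last first.
  by rewrite mulr_ge0 ?sqr_ge0 ?expR_ge0.
have -> : B ^+ 2 * expR (- (2 * k) * `|x|) = (B * expR (- k * `|x|)) ^+ 2.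
  rewrite exprMn; congr (_ * _); rewrite expr2 -expRD; congr expR; ring.
by rewrite ler_sqr ?nnegrE ?(le_trans _ (fB x)).
Qed.

(** Chebyshev's inequality: with I the integral of h, a window of length [I / e + 1] on which
    [h >= e] would already carry [I + e]. The length does not depend on the position, so a window
    fits on either side of the origin. *)
Lemma integrable_small_value (h : R -> R) (e : R) : 0 < e ->
  (forall x, 0 <= h x) -> leb.-integrable setT (EFin \o h) ->
  exists2 B : R, 0 < B & forall a, exists2 x, a < x < a + B & h x < e.
Proof.
move=> e0 h0 ih; have /integrableP[mh foo] := ih.
have I0 : (0 <= \int[leb]_x `|(EFin \o h) x|)%E by exact: integral_ge0.
pose I := fine (\int[leb]_x `|(EFin \o h) x|)%E.
have IE : (\int[leb]_x `|(EFin \o h) x| = I%:E)%E by rewrite fineK // ge0_fin_numE.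
have I00 : 0 <= I by rewrite -lee_fin -IE.
exists (I / e + 1) => [|a]; first by rewrite ltr_wpDl // divr_ge0 // ltW.
apply: contrapT => none.
have big x : a < x < a + (I / e + 1) -> e <= h x.
  by move=> xB; rewrite leNgt; apply/negP => hx; apply: none; exists x.
have B0 : 0 < I / e + 1 by rewrite ltr_wpDl // divr_ge0 // ltW.
have : (\int[leb]_(x in `]a, (a + (I / e + 1))%R[) e%:E <= I%:E)%E.
  rewrite -IE; apply: (@le_trans _ _ (\int[leb]_(x in `]a, (a + (I / e + 1))%R[) `|(EFin \o h) x|)%E).
    apply: ge0_le_integral => //.
    - by move=> x _; rewrite lee_fin ltW.
    - apply: measurableT_comp => //; apply: measurable_funTS; exact: mh.
    move=> x /=; rewrite in_itv /= => /big hx.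
    by rewrite lee_fin ger0_norm.
  by apply: ge0_subset_integral => //; exact: measurableT_comp.
rewrite integral_cst //= lebesgue_measure_itv /= lte_fin ltrDl B0 -EFinB -EFinM lee_fin.
have -> : e * (a + (I / e + 1) - a) = I + e by field; rewrite gt_eqF.
by rewrite gerDl leNgt e0.
Qed.

(* The equation is only known almost everywhere; it determines a continuous
   representative of the weak derivative. *)
Lemma weak_derivative_ae (Omega : set R) (f g g' : R -> R) : measurable Omega ->
  measurable_fun Omega g -> measurable_fun Omega g' ->
  {ae leb, forall x, Omega x -> g x = g' x} ->
  weak_derivative Omega f g -> weak_derivative Omega f g'.
Proof.
move=> mO mg mg' gg' w phi tphi; rewrite w //; congr (- fine _).
have mphi : measurable_fun Omega phi.
  apply: measurable_funTS; apply: continuous_measurable_fun => x.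
  by have [dphi _ _] := tphi; apply: is_derive_continuous (derivableP (dphi x)).
apply: ae_eq_integral => //.
- by apply/measurable_EFinP; apply: measurable_funM.
- by apply/measurable_EFinP; apply: measurable_funM.
have [A [mA A0 sA]] := gg'; exists A; split => // x nP.
by apply: sA => H; apply: nP => Ox /=; rewrite H.
Qed.

End SquareIntegrable.

(** * Limits of complex-valued functions by components *)

Section ComplexLimits.
Variable R : realType.
Notation Ci := (R[i] : numFieldType).

Lemma cvg_Re (T : Type) (F : set_system T) (FF : Filter F) (f : T -> Ci) (l : Ci) :
  f @ F --> l -> complex.Re (f x) @[x --> F] --> complex.Re l.
Proof.
move=> /cvgrPdist_lt H; apply/cvgrPdist_lt => e e0.
have /H : (0 : Ci) < e%:C by rewrite ltcR.
apply: filterS => x; rewrite -ltcR; apply: le_lt_trans.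
by rewrite -raddfB; exact: normc_ge_Re.
Qed.

Lemma cvg_Im (T : Type) (F : set_system T) (FF : Filter F) (f : T -> Ci) (l : Ci) :
  f @ F --> l -> complex.Im (f x) @[x --> F] --> complex.Im l.
Proof.
move=> /cvgrPdist_lt H; apply/cvgrPdist_lt => e e0.
have /H : (0 : Ci) < e%:C by rewrite ltcR.
apply: filterS => x; rewrite -ltcR; apply: le_lt_trans.
rewrite -raddfB normc_def lecR -sqrtr_sqr ler_wsqrtr // lerDr sqr_ge0 //.
Qed.

Lemma cvg_real_complex (T : Type) (F : set_system T) (FF : Filter F) (f : T -> R) (l : R) :
  f x @[x --> F] --> l -> ((f x)%:C : Ci) @[x --> F] --> (l%:C : Ci).
Proof.
move=> /cvgrPdist_lt H; apply/cvgrPdist_lt => e e0.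
(* The order of [R[i]] only compares numbers with equal imaginary parts, so a positive [e] is
   real. *)
have eE : e = (complex.Re e)%:C by case: e e0 => a b; rewrite ltcE => /andP[/eqP /= -> _].
have /H : 0 < complex.Re e by rewrite -ltcR -eE.
apply: filterS => x fx; rewrite eE -rmorphB /= normc_def /= expr0n /= addr0 sqrtr_sqr ltcR.
exact: fx.
Qed.

Lemma cvg_scaled_real (T : Type) (F : set_system T) (FF : Filter F) (c : Ci)
    (f : T -> R) (l : R) :
  f x @[x --> F] --> l -> (c * (f x)%:C : Ci) @[x --> F] --> (c * l%:C : Ci).
Proof. by move=> fl; apply: cvgM; [exact: cvg_cst | exact: cvg_real_complex]. Qed.

End ComplexLimits.

(** * Solutions are matched solitons *)

Section Regularity.
Variable R : realType.
Notation leb := (@lebesgue_measure R).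
Notation Ci := (R[i] : numFieldType).
Implicit Types mu omega : R.

Lemma continuous_norm_powR (mu : R) : 0 < mu ->
  continuous (fun t : R => `|t| `^ mu).
Proof.
move=> mu0 t; have [->|t0] := eqVneq t 0.
  rewrite /continuous_at normr0 powR0 ?gt_eqF //.
  apply/cvgrPdist_lt => e e0.
  have [r /= r0 Hr] : \forall a \near 0^'+, `|a `^ mu| < e.
    have /cvgrPdist_lt /(_ e e0) := @powR_cvg0 R mu mu0.
    by apply: filterS => a; rewrite sub0r normrN.
  near=> y; rewrite sub0r normrN.
  have [->|y0] := eqVneq y 0; first by rewrite normr0 powR0 ?gt_eqF // normr0.
  apply: Hr; last by rewrite normr_gt0.
  rewrite /= sub0r normrN normr_id.
  by near: y; apply: (@nbhs0_lt R R^o).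
apply: (@continuous_comp _ _ _ (fun t : R => `|t|) (fun t => t `^ mu)).
  exact: norm_continuous.
by apply: is_derive_continuous (is_derive1_powR mu _); rewrite normr_gt0.
Unshelve. all: by end_near. Qed.

Lemma normc_powR (z : R[i]) mu :
  Normc.normc z `^ (2 * mu) = (complex.Re z ^+ 2 + complex.Im z ^+ 2) `^ mu.
Proof.
case: z => a b; rewrite /Normc.normc /= powRrM powR_mulrn ?sqrtr_ge0 //.
by rewrite sqr_sqrtr // addr_ge0 ?sqr_ge0.
Qed.

Lemma stationary_eq_components mu omega (z w : R[i]) :
  - w - (Normc.normc z `^ (2 * mu))%:C * z + omega%:C * z = 0 ->
  complex.Re w = (omega - (complex.Re z ^+ 2 + complex.Im z ^+ 2) `^ mu) * complex.Re z /\
  complex.Im w = (omega - (complex.Re z ^+ 2 + complex.Im z ^+ 2) `^ mu) * complex.Im z.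
Proof.
rewrite -normc_powR; case: z w => a b [c d] /=.
set m := _ `^ _; move/eqP; rewrite eq_complex /= => /andP[/eqP E1 /eqP E2].
by split; lra.
Qed.

(** The equation identifies u'' almost everywhere with a function of u that is continuous off the
    origin. That function is thus also a weak derivative of u', and weak derivatives between
    continuous functions are classical. *)
Lemma solution_smooth mu omega (u u1 u2 : R -> R[i]) : 0 < mu ->
  H2_off0 u u1 u2 -> stationary_eq mu omega u u2 ->
  let p x := complex.Re (u x) in let q x := complex.Im (u x) in
  let p1 x := complex.Re (u1 x) in let q1 x := complex.Im (u1 x) in
  forall x : R, x != 0 ->
  [/\ is_derive x 1 p (p1 x), is_derive x 1 q (q1 x),
      is_derive x 1 p1 ((omega - (p x ^+ 2 + q x ^+ 2) `^ mu) * p x) &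
      is_derive x 1 q1 ((omega - (p x ^+ 2 + q x ^+ 2) `^ mu) * q x)].
Proof.
move=> mu0 [[L0 L1 L2u] [wp wq] [wp1 wq1] cu cu1] eqn p q p1 q1.
have cp (x : R) : x != 0 -> {for x, continuous p}.
  by move=> x0; apply: (@cvg_Re R R (nbhs x) _ u (u x)); exact: cu.
have cq (x : R) : x != 0 -> {for x, continuous q}.
  by move=> x0; apply: (@cvg_Im R R (nbhs x) _ u (u x)); exact: cu.
have cp1 (x : R) : x != 0 -> {for x, continuous p1}.
  by move=> x0; apply: (@cvg_Re R R (nbhs x) _ u1 (u1 x)); exact: cu1.
have cq1 (x : R) : x != 0 -> {for x, continuous q1}.
  by move=> x0; apply: (@cvg_Im R R (nbhs x) _ u1 (u1 x)); exact: cu1.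
pose V x := omega - (p x ^+ 2 + q x ^+ 2) `^ mu.
have cV (x : R) : x != 0 -> {for x, continuous V}.
  move=> x0; have -> : V = (fun x => omega - `|p x * p x + q x * q x| `^ mu).
    by apply/funext => y; rewrite /V ger0_norm // -!expr2 addr_ge0 ?sqr_ge0.
  apply: continuousB; first exact: cvg_cst.
  apply: (@continuous_comp _ _ _ (fun x => p x * p x + q x * q x) (fun t => `|t| `^ mu)).
    by apply: continuousD; apply: continuousM; [exact: cp|exact: cp|exact: cq|exact: cq].
  exact: continuous_norm_powR.
have cVp (x : R) : x != 0 -> {for x, continuous (fun x => V x * p x)}.
  by move=> x0; apply: continuousM; [exact: cV | exact: cp].
have cVq (x : R) : x != 0 -> {for x, continuous (fun x => V x * q x)}.
  by move=> x0; apply: continuousM; [exact: cV | exact: cq].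
have mO : measurable (@punctured_line R) by apply: open_measurable; exact: open_neq.
have [m2 m2'] : measurable_fun setT (fun x => complex.Re (u2 x)) /\
    measurable_fun setT (fun x => complex.Im (u2 x)).
  case: L2u; rewrite !inE => /andP[h _] /andP[h' _].
  by move: h h'; rewrite !inE.
have {}wp1 : weak_derivative (@punctured_line R) p1 (fun x => V x * p x).
  apply: (weak_derivative_ae mO _ _ _ wp1).
  - exact: measurable_funTS.
  - by apply: measurable_funTS; exact: measurable_continuous_off0.
  - have [A [mA A0 sA]] := eqn; exists A; split => // x nP.
    apply: sA => H; apply: nP => Ox /=.
    by have [] := stationary_eq_components (H Ox).
have {}wq1 : weak_derivative (@punctured_line R) q1 (fun x => V x * q x).
  apply: (weak_derivative_ae mO _ _ _ wq1).
  - exact: measurable_funTS.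
  - by apply: measurable_funTS; exact: measurable_continuous_off0.
  - have [A [mA A0 sA]] := eqn; exists A; split => // x nP.
    apply: sA => H; apply: nP => Ox /=.
    by have [] := stationary_eq_components (H Ox).
move=> x x0; split.
- exact: (weak_derivative_derivable wp cp cp1 x0).
- exact: (weak_derivative_derivable wq cq cq1 x0).
- exact: (weak_derivative_derivable wp1 cp1 cVp x0).
- exact: (weak_derivative_derivable wq1 cq1 cVq x0).
Qed.

Lemma solution_small (u u1 : R -> R[i]) (e : R) : L2 u -> L2 u1 -> 0 < e ->
  exists2 B : R, 0 < B & forall a, exists2 x, a < x < a + B &
    complex.Re (u x) ^+ 2 + complex.Im (u x) ^+ 2 +
    (complex.Re (u1 x) ^+ 2 + complex.Im (u1 x) ^+ 2) < e.
Proof.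
move=> [/Lfun2_integrable_sqr i1 /Lfun2_integrable_sqr i2].
move=> [/Lfun2_integrable_sqr i3 /Lfun2_integrable_sqr i4] e0.
apply: integrable_small_value => //.
  by move=> x; rewrite !addr_ge0 ?sqr_ge0.
have i5 := integrableD measurableT (integrableD measurableT i1 i2) (integrableD measurableT i3 i4).
apply: eq_integrable i5 => // x _ /=.
Qed.

Lemma is_derive_reflect (f : R -> R) (x d : R) :
  is_derive (- x) 1 f d -> is_derive x 1 (fun x => f (- x)) (- d).
Proof.
rewrite -mulN1r => h; have := is_derive_comp_scale h; rewrite mulN1r.
by under eq_fun do rewrite mulN1r.
Qed.

End Regularity.

Section Classification.
Variable R : realType.
Notation Ci := (R[i] : numFieldType).
Implicit Types mu omega tau v : R.

Definition soliton' mu omega (x : R) : R :=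
  - Num.sqrt omega * T_of mu omega x * soliton mu omega x.

Lemma T_ofN mu omega (x : R) : T_of mu omega (- x) = - T_of mu omega x.
Proof.
rewrite /T_of mulrN; set y := _ * x.
by rewrite /tanh opprK (addrC (expR (- y)) (expR y)) -[RHS]mulNr opprB.
Qed.

Lemma complex_scale (c d s : R) (z : R[i]) :
  complex.Re z = c * s -> complex.Im z = d * s -> z = (c +i* d)%C * s%:C.
Proof.
case: z => a b /= -> ->; apply/eqP; rewrite eq_complex /=.
by rewrite !mulr0 subr0 add0r !eqxx.
Qed.

Lemma half_lines_of_solution mu omega (u u1 u2 : R -> R[i]) : 0 < mu ->
  H2_off0 u u1 u2 -> stationary_eq mu omega u u2 ->
  exists (A B : R[i]) (xp xm : R),
  [/\ A = 0 \/ 0 < omega /\ Normc.normc A = 1,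
      B = 0 \/ 0 < omega /\ Normc.normc B = 1,
      forall x, 0 < x -> u x = A * (soliton mu omega (x + xp))%:C /\
        u1 x = A * (soliton' mu omega (x + xp))%:C &
      forall x, x < 0 -> u x = B * (soliton mu omega (x + xm))%:C /\
        u1 x = B * (soliton' mu omega (x + xm))%:C].
Proof.
move=> mu0 H2u eqn.
have sm := solution_smooth mu0 H2u eqn.
have [[L0 L1 _] _ _ _ _] := H2u.
have smallu e e0 := @solution_small R u u1 e L0 L1 e0.
have phase (c d : R) : c = 0 /\ d = 0 \/ 0 < omega /\ c ^+ 2 + d ^+ 2 = 1 ->
    (c +i* d)%C = 0 \/ 0 < omega /\ Normc.normc (c +i* d)%C = 1.
  case=> [[-> ->]|[om0 cd]]; first by left.
  by right; split => //; rewrite /Normc.normc cd sqrtr1.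
have [|||||xp [c [d [/phase cd Hr]]]] := @half_line_classification R mu omega
  (fun x => complex.Re (u x)) (fun x => complex.Im (u x))
  (fun x => complex.Re (u1 x)) (fun x => complex.Im (u1 x)) mu0.
- by move=> x x0; have [] := sm x (lt0r_neq0 x0).
- by move=> x x0; have [] := sm x (lt0r_neq0 x0).
- by move=> x x0; have [] := sm x (lt0r_neq0 x0).
- by move=> x x0; have [] := sm x (lt0r_neq0 x0).
- move=> e /smallu[b b0 /(_ 0)[x /andP[x0 _] h]].
  by exists x.
(* The equation is invariant under [x |-> - x], with u' changing sign, so the negative half-line is
   handled by reflection. *)
have [|||||xm [c' [d' [/phase cd' Hl]]]] := @half_line_classification R mu omega
  (fun x => complex.Re (u (- x))) (fun x => complex.Im (u (- x)))
  (fun x => - complex.Re (u1 (- x))) (fun x => - complex.Im (u1 (- x))) mu0.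
- move=> x x0; have nx0 : - x != 0 by rewrite oppr_eq0 lt0r_neq0.
  by have [h _ _ _] := sm (- x) nx0; exact: (is_derive_reflect h).
- move=> x x0; have nx0 : - x != 0 by rewrite oppr_eq0 lt0r_neq0.
  by have [_ h _ _] := sm (- x) nx0; exact: (is_derive_reflect h).
- move=> x x0; have nx0 : - x != 0 by rewrite oppr_eq0 lt0r_neq0.
  have [_ _ h _] := sm (- x) nx0.
  have h2 := is_deriveN (is_derive_reflect h).
  by apply: (is_derive_eq h2); rewrite opprK.
- move=> x x0; have nx0 : - x != 0 by rewrite oppr_eq0 lt0r_neq0.
  have [_ _ _ h] := sm (- x) nx0.
  have h2 := is_deriveN (is_derive_reflect h).
  by apply: (is_derive_eq h2); rewrite opprK.
(* The window of length [b] starting at [- b] lies in the negative half-line. *)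
- move=> e /smallu[b b0 /(_ (- b))[x /andP[_ x0] h]].
  exists (- x); first by rewrite oppr_gt0; move: x0; rewrite addNr.
  by rewrite !opprK !sqrrN.
exists (c +i* d)%C, (c' +i* d')%C, xp, (- xm); split => //.
  move=> x x0; have [h1 h2 h3 h4] := Hr x x0; split; apply: complex_scale => //.
    by rewrite h3 h1 /soliton'; ring.
  by rewrite h4 h2 /soliton'; ring.
move=> x x0; have nx0 : 0 < - x by rewrite oppr_gt0.
have [] := Hl (- x) nx0; rewrite !opprK.
have -> : - x + xm = - (x - xm) by rewrite opprB addrC.
rewrite solitonN T_ofN => h1 h2 h3 h4; split; apply: complex_scale => //.
  by apply: oppr_inj; rewrite h3 h1 /soliton'; ring.
by apply: oppr_inj; rewrite h4 h2 /soliton'; ring.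
Qed.

Lemma cvg_half_line (F : set_system R) (A l : Ci) (w : R -> R[i]) (f : R -> R) (x0 : R) :
  ProperFilter F -> F --> (0 : R) -> (\forall x \near F, w x = A * (f (x + x0))%:C) ->
  continuous f -> (w x : Ci) @[x --> F] --> l -> l = A * (f x0)%:C.
Proof.
move=> PF F0 wE cf wl.
have fl : f (x + x0) @[x --> F] --> f x0.
  apply: (@cvg_comp _ _ _ (fun x => x + x0) f _ (nbhs x0)); last exact: cf.
  have := @cvgD R R^o R F _ id (fun=> x0) 0 x0 F0 (cvg_cst _).
  by rewrite add0r; apply.
have h := @cvg_scaled_real R R F _ A (fun x => f (x + x0)) _ fl.
have U := @cvg_unique Ci (@norm_hausdorff _ Ci) ((w : R -> Ci) @ F) _ l (A * (f x0)%:C) wl.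
apply: U.
by apply: cvg_trans (h _); apply: near_eq_cvg; apply: filterS wE => x ->.
Qed.

End Classification.

(** * The vertex conditions in terms of amplitudes, phases and T *)

Section VertexAlgebra.
Variable R : realType.
Implicit Types (A B : R[i]) (k t v : R).

Lemma normc_real (x : R) : Normc.normc (x%:C) = `|x|.
Proof. by rewrite /Normc.normc /= expr0n addr0 sqrtr_sqr. Qed.

Lemma normc_scaled A (x : R) : Normc.normc (A * x%:C) = Normc.normc A * `|x|.
Proof. by rewrite Normc.normcM normc_real. Qed.

Lemma real_complexM (x y : R) : (x * y)%:C = x%:C * y%:C :> R[i].
Proof. exact: rmorphM. Qed.

Lemma real_complex_neq0 (x : R) : x != 0 -> x%:C != 0 :> R[i].
Proof. by move=> x0; rewrite eq_complex /= eqxx andbT. Qed.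

Lemma flux_algebra k t v (T P S : R) : 0 < k -> 0 < S ->
  - k * T * S - t * (- k * P * (t * S)) = v * S <-> t ^+ 2 * P = T + v / k.
Proof.
move=> k0 S0; split=> h.
  apply: (mulfI (lt0r_neq0 k0)); apply: (mulfI (lt0r_neq0 S0)).
  have -> : S * (k * (T + v / k)) = S * (k * T) + v * S.
    by field; rewrite gt_eqF.
  by rewrite -h; ring.
have -> : T = t ^+ 2 * P - v / k by rewrite h addrK.
by field; rewrite gt_eqF.
Qed.

(** Taking moduli separates the amplitudes from the unit factors; cancelling the amplitudes leaves
    only the sign of t between the phases. *)
Lemma vertex_phase A B t (Sp Sm : R) :
  Normc.normc A = 1 -> Normc.normc B = 1 -> 0 < Sp -> 0 < Sm ->
  A * Sp%:C = t%:C * (B * Sm%:C) ->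
  Sp = `|t| * Sm /\ A = (Num.sg t)%:C * B.
Proof.
move=> A1 B1 Sp0 Sm0 E.
have E1 : Sp = `|t| * Sm.
  have := congr1 (@Normc.normc R) E.
  by rewrite (mulrCA t%:C B) -real_complexM !normc_scaled A1 B1 !mul1r normrM
    (gtr0_norm Sp0) (gtr0_norm Sm0).
split => //; apply: (mulIf (real_complex_neq0 (lt0r_neq0 Sp0))).
have tE : t%:C = (Num.sg t)%:C * `|t|%:C :> R[i].
  by rewrite -real_complexM mulr_sg_norm.
by rewrite E E1 real_complexM tE; ring.
Qed.

Lemma vertex_flux B t v (Sm dm dp : R) : B != 0 ->
  B * dm%:C - t%:C * (B * (Num.sg t * dp)%:C) = v%:C * (B * Sm%:C) <->
  dm - `|t| * dp = v * Sm.
Proof.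
move=> B0.
have -> : B * dm%:C - t%:C * (B * (Num.sg t * dp)%:C) = B * (dm - `|t| * dp)%:C.
  have -> : `|t| = t * Num.sg t by rewrite mulrC -normrEsg.
  by rewrite rmorphB /= !real_complexM; ring.
have -> : v%:C * (B * Sm%:C) = B * (v * Sm)%:C by rewrite real_complexM; ring.
by split=> [/(mulfI B0)[]|->].
Qed.

Lemma vertex_flux_phase A B t v (Sm dm dp : R) : B != 0 -> A = (Num.sg t)%:C * B ->
  B * dm%:C - t%:C * (A * dp%:C) = v%:C * (B * Sm%:C) -> dm - `|t| * dp = v * Sm.
Proof.
move=> B0 -> E; apply/(vertex_flux t v Sm dm dp B0); rewrite -E real_complexM.
by congr (_ - _ * _); rewrite mulrA [B * _]mulrC.
Qed.

End VertexAlgebra.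

Section Matching.
Variables (R : realType) (mu tau v : R).
Hypotheses (mu0 : 0 < mu) (tau0 : tau != 0) (tau1 : tau != 1) (tauN1 : tau != -1).
Notation Ci := (R[i] : numFieldType).

Lemma ratio_gt0 : 0 < `|tau| `^ (2 * mu).
Proof. by rewrite powR_gt0 // normr_gt0. Qed.

(** Both powers increase with [|tau|] and equal 1 at [|tau| = 1]. Besides positivity, this is all
    that the root analysis uses of the relation between them. *)
Lemma ratio_side : 0 < (`|tau| `^ (2 * mu) - 1) * (tau ^+ 2 - 1).
Proof.
have t0 : 0 < `|tau| by rewrite normr_gt0.
have m20 : 0 < 2 * mu by rewrite mulr_gt0.
have t1 : `|tau| != 1.
  by rewrite eqr_norml ler01 andbT negb_or tau1 tauN1.
rewrite -(real_normK (num_real tau)).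
have one : 1 `^ (2 * mu) = 1 :> R by rewrite powR1.
have [lt1|gt1] : `|tau| < 1 \/ 1 < `|tau| by case: ltrgtP t1 => //; [left|right].
  rewrite nmulr_rgt0 ?subr_lt0 ?expr_lt1 //.
  rewrite -[X in _ < X]one; apply: gt0_ltr_powR; rewrite ?nnegrE //.
rewrite mulr_gt0 ?subr_gt0 ?expr_gt1 //.
by rewrite -[X in X < _]one; apply: gt0_ltr_powR; rewrite ?nnegrE.
Qed.

Lemma T_systemE (omega T P : R) : T_system mu tau v omega T P <->
  (tau ^+ 2 * P = T + v / Num.sqrt omega /\
   1 - P ^+ 2 = `|tau| `^ (2 * mu) * (1 - T ^+ 2)).
Proof.
have a0 := ratio_gt0; have side := ratio_side.
rewrite /T_system; set a := `|tau| `^ (2 * mu) in a0 side *.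
have a1 : a - 1 != 0 by apply: contraTneq side => ->; rewrite mul0r ltxx.
have s0 : tau ^+ 2 != 0 by rewrite sqrf_eq0.
have -> : T ^+ 2 / (1 - a^-1) - P ^+ 2 / (a - 1) = (a * T ^+ 2 - P ^+ 2) / (a - 1).
  field; rewrite a1 gt_eqF //= .
split=> [[-> h]|[h1 h2]].
  split; first by rewrite mulrA mulfV // mul1r.
  by move/(congr1 (fun z => z * (a - 1))): h; rewrite divfK // mul1r => h; lra.
split; first by rewrite -h1 mulrA mulVf // mul1r.
have -> : a * T ^+ 2 - P ^+ 2 = a - 1 by lra.
by rewrite divff.
Qed.

(** Raising the amplitude relation to the power [2 mu], which is injective on positive numbers,
    gives the quadratic equation; dividing the flux relation by [sqrt omega] and the amplitude gives
    the linear one. *)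
Lemma vertexE (omega xm xp : R) : 0 < omega ->
  T_system mu tau v omega (T_of mu omega xm) (T_of mu omega xp) <->
  (soliton mu omega xp = `|tau| * soliton mu omega xm /\
   soliton' mu omega xm - `|tau| * soliton' mu omega xp = v * soliton mu omega xm).
Proof.
move=> om0; rewrite T_systemE.
have k0 : 0 < Num.sqrt omega by rewrite sqrtr_gt0.
have m20 : 0 < 2 * mu by rewrite mulr_gt0.
have t0 : 0 < `|tau| by rewrite normr_gt0.
have Sm0 := soliton_gt0 mu0 om0 xm; have Sp0 := soliton_gt0 mu0 om0 xp.
have om1 : omega * (mu + 1) != 0 by rewrite gt_eqF // mulr_gt0 // addr_gt0.
have E1 : 1 - T_of mu omega xp ^+ 2 = `|tau| `^ (2 * mu) * (1 - T_of mu omega xm ^+ 2) <->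
    soliton mu omega xp = `|tau| * soliton mu omega xm.
  split=> [E|E].
    apply: (powR_injective m20); rewrite ?nnegrE ?(mulr_ge0 (ltW t0) (ltW Sm0)) ?(ltW Sp0) //.
    rewrite /= (@powRM _ `|tau|) ?(ltW Sm0) //.
    apply: etrans (soliton_powR mu0 om0 xp) _; rewrite E mulrCA; congr (_ * _).
    exact: esym (soliton_powR mu0 om0 xm).
  apply: (mulfI om1); rewrite -soliton_powR // E (@powRM _ `|tau|) ?(ltW Sm0) // soliton_powR //.
  by ring.
have tt : `|tau| ^+ 2 = tau ^+ 2 by rewrite real_normK // num_real.
rewrite E1 /soliton'; split=> -[h1 h2]; split => //.
  by rewrite h2 flux_algebra // tt.
by move: h2; rewrite h1 flux_algebra // tt.
Qed.

Lemma continuous_soliton (omega : R) : continuous (soliton mu omega).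
Proof. by move=> x; apply: is_derive_continuous (is_derive_soliton omega mu0 x). Qed.

Lemma continuous_soliton' (omega : R) : 0 < omega -> continuous (soliton' mu omega).
Proof. by move=> om0 x; apply: is_derive_continuous (is_derive_soliton2 mu0 om0 x). Qed.

Lemma solution_form (omega : R) (u : R -> R[i]) : solution mu tau v omega u ->
  0 < omega /\ exists xm xp : R,
    T_system mu tau v omega (T_of mu omega xm) (T_of mu omega xp) /\
    phase_equiv u (matched_soliton mu tau omega xm xp).
Proof.
move=> [[y [y0 uy]] [u1 [u2 [H2u eqn [ul [ur [dl [dr [[lul lur ldl ldr] [v1 v2]]]]]]]]]].
have [A [B [xp [xm [hA hB Hr Hl]]]]] := half_lines_of_solution mu0 H2u eqn.
have AB0 : A = 0 -> B = 0 -> False.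
  move=> A0 B0; move/eqP: uy; apply.
  have [y_lt|y_gt|] := ltgtP y 0; last by move/eqP; rewrite (negbTE y0).
    by rewrite (Hl y y_lt).1 B0 mul0r.
  by rewrite (Hr y y_gt).1 A0 mul0r.
have om0 : 0 < omega.
  case: hA => [A0|[]//]; case: hB => [B0|[]//].
  by case: (AB0 A0 B0).
have cS := @continuous_soliton omega; have cS' := @continuous_soliton' omega om0.
have fr : (0 : R)^'+ --> (0 : R) by exact: cvg_at_right_filter (@cvg_id _ _).
have fl : (0 : R)^'- --> (0 : R) by exact: cvg_at_left_filter (@cvg_id _ _).
have nr (P : R -> Prop) : (forall x, 0 < x -> P x) -> \forall x \near 0^'+, P x.
  by move=> h; near=> x; apply: h.
have nl (P : R -> Prop) : (forall x, x < 0 -> P x) -> \forall x \near 0^'-, P x.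
  by move=> h; near=> x; apply: h.
have urE : ur = A * (soliton mu omega xp)%:C.
  by apply: (cvg_half_line _ fr _ cS lur); apply: nr => x /Hr[].
have drE : dr = A * (soliton' mu omega xp)%:C.
  by apply: (cvg_half_line _ fr _ cS' ldr); apply: nr => x /Hr[].
have ulE : ul = B * (soliton mu omega xm)%:C.
  by apply: (cvg_half_line _ fl _ cS lul); apply: nl => x /Hl[].
have dlE : dl = B * (soliton' mu omega xm)%:C.
  by apply: (cvg_half_line _ fl _ cS' ldl); apply: nl => x /Hl[].
move: v1 v2; rewrite {}urE {}drE {}ulE {}dlE => v1 v2.
have Sm0 := soliton_gt0 mu0 om0 xm; have Sp0 := soliton_gt0 mu0 om0 xp.
have t0 : 0 < `|tau| by rewrite normr_gt0.
(* Since solitons are positive and [tau] is nonzero, vanishing on one half-line would cross the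
   vertex and make u vanish on both. *)
have nA : A != 0.
  apply/eqP => A0; apply: (AB0 A0); move/eqP: v1; rewrite A0 mul0r eq_sym.
  by rewrite !mulf_eq0 (negbTE (real_complex_neq0 tau0))
    (negbTE (real_complex_neq0 (lt0r_neq0 Sm0))) orbF => /eqP.
have nB : B != 0.
  apply/eqP => B0; apply: (AB0 _ B0); move/eqP: v1; rewrite B0 mul0r mulr0.
  by rewrite mulf_eq0 (negbTE (real_complex_neq0 (lt0r_neq0 Sp0))) orbF => /eqP.
have A1 : Normc.normc A = 1 by case: hA => [A0|[]//]; rewrite A0 eqxx in nA.
have B1 : Normc.normc B = 1 by case: hB => [B0|[]//]; rewrite B0 eqxx in nB.
have [SE AE] := vertex_phase A1 B1 Sp0 Sm0 v1.
split => //; exists xm, xp; split.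
  apply/(vertexE xm xp om0); split; first exact: SE.
  exact: vertex_flux_phase nB AE v2.
exists B; split => // x x0; rewrite /matched_soliton.
have [x_lt|x_gt|/eqP] := ltgtP x 0; last by rewrite (negbTE x0).
  by rewrite (Hl x x_lt).1.
by rewrite (Hr x x_gt).1 AE (real_complexM (Num.sg tau)) [RHS]mulrA (mulrC B).
Unshelve. all: by end_near. Qed.

End Matching.

(** * Matched solitons are solutions *)

Section Glued.
Variables (R : realType) (sgn xm xp : R).
Notation Ci := (R[i] : numFieldType).
Notation leb := (@lebesgue_measure R).
Implicit Types (f g : R -> R) (c : R[i]) (w : R -> R[i]).

(** The profile is left abstract so that u, u' and u'' are all glued in the same way from the
    soliton and its derivatives. *)
Definition glued f (x : R) : R := if x < 0 then f (x + xm) else sgn * f (x + xp).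

Lemma glued_left f (x : R) : x < 0 -> \forall y \near x, f (y + xm) = glued f y.
Proof.
move=> x0; near=> y; have y0 : y < 0 by near: y; exact: lt_nbhsl.
by rewrite /glued y0.
Unshelve. all: by end_near. Qed.

Lemma glued_right f (x : R) : 0 < x -> \forall y \near x, sgn * f (y + xp) = glued f y.
Proof.
move=> x0; near=> y; have y0 : 0 < y by near: y; exact: lt_nbhsr.
by rewrite /glued ltNge (ltW y0).
Unshelve. all: by end_near. Qed.

Lemma is_derive_translate f (a x d : R) :
  is_derive (x + a) 1 f d -> is_derive x 1 (fun x => f (x + a)) d.
Proof.
move=> h1; have h2 : is_derive x 1 (fun x : R => x + a) 1.
  by apply: trigger_derive; ring.
by have := @is_derive1_comp R f (fun x => x + a) x _ _ h1 h2; rewrite mulr1.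
Qed.

Lemma is_derive_glued f g : (forall y : R, is_derive y 1 f (g y)) ->
  forall x : R, x != 0 -> is_derive x 1 (glued f) (glued g x).
Proof.
move=> df x x0; have [x_lt|x_gt|/eqP] := ltgtP x 0; last by rewrite (negbTE x0).
  apply: near_eq_is_derive (glued_left f x_lt) _.
  by rewrite /glued x_lt; exact: is_derive_translate.
apply: near_eq_is_derive (glued_right f x_gt) _.
rewrite /glued ltNge (ltW x_gt) /=.
exact: (is_deriveZ sgn (is_derive_translate (df (x + xp)))).
Qed.

Lemma continuous_translate f (a : R) : continuous f -> continuous (fun x => f (x + a)).
Proof.
move=> cf x; apply: (@continuous_comp _ _ _ (fun x => x + a) f); last exact: cf.
by apply: continuousD; [exact: cvg_id | exact: cvg_cst].
Qed.

Lemma continuous_glued f : continuous f ->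
  forall x : R, x != 0 -> {for x, continuous (glued f)}.
Proof.
move=> cf x x0; have [x_lt|x_gt|/eqP] := ltgtP x 0; last by rewrite (negbTE x0).
  rewrite /prop_for /continuous_at -(nbhs_singleton (glued_left f x_lt)).
  apply: (@cvg_trans _ ((fun y => f (y + xm)) @ x)).
    by apply: near_eq_cvg; exact: glued_left.
  exact: continuous_translate.
rewrite /prop_for /continuous_at -(nbhs_singleton (glued_right f x_gt)).
apply: (@cvg_trans _ ((fun y => sgn * f (y + xp)) @ x)).
  by apply: near_eq_cvg; exact: glued_right.
apply: (@continuousM R R (fun=> sgn) (fun y => f (y + xp)) x); first exact: cvg_cst.
exact: continuous_translate.
Qed.

(** A translation by a costs a factor [exp (k |a|)]; adding the constants of both sides avoids a
    maximum. *)
Lemma glued_decay f (C k : R) : 0 <= k -> (forall y, `|f y| <= C * expR (- k * `|y|)) ->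
  exists D : R, forall x, `|glued f x| <= D * expR (- k * `|x|).
Proof.
move=> k0 fC.
have C0 : 0 <= C.
  have := fC 0; rewrite normr0 mulr0 expR0 mulr1; exact: le_trans.
have tr a x : `|f (x + a)| <= C * expR (k * `|a|) * expR (- k * `|x|).
  apply: le_trans (fC _) _; rewrite -mulrA ler_wpM2l // -expRD ler_expR.
  have := ler_normB (x + a) a; rewrite addrK => h.
  have : k * `|x| <= k * (`|x + a| + `|a|) by rewrite ler_wpM2l.
  lra.
exists (C * expR (k * `|xm|) + `|sgn| * (C * expR (k * `|xp|))) => x.
have p1 : 0 <= C * expR (k * `|xm|) * expR (- k * `|x|) by rewrite !mulr_ge0 ?expR_ge0.
have p2 : 0 <= `|sgn| * (C * expR (k * `|xp|)) * expR (- k * `|x|) by rewrite !mulr_ge0 ?expR_ge0.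
rewrite mulrDl /glued; case: ifP => _.
  by apply: le_trans (tr _ _) _; rewrite lerDl.
rewrite normrM; apply: (@le_trans _ _ (`|sgn| * (C * expR (k * `|xp|) * expR (- k * `|x|)))).
  by rewrite ler_wpM2l.
by rewrite mulrA lerDr.
Qed.

Lemma Re_scaled c (r : R) : complex.Re (c * r%:C) = complex.Re c * r.
Proof. by case: c => a b /=; rewrite mulr0 subr0. Qed.

Lemma Im_scaled c (r : R) : complex.Im (c * r%:C) = complex.Im c * r.
Proof. by case: c => a b /=; rewrite mulr0 add0r. Qed.

Lemma near_off0 (T : Type) (w w' : R -> T) : (forall x : R, x != 0 -> w x = w' x) ->
  forall x : R, x != 0 -> \forall y \near x, w' y = w y.
Proof.
move=> ww x x0; near=> y; apply/esym/ww; near: y.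
by apply: open_nbhs_nbhs; split => //; exact: open_neq.
Unshelve. all: by end_near. Qed.

Lemma glued_continuous_off0 c f w : continuous f ->
  (forall x : R, x != 0 -> w x = c * (glued f x)%:C) -> continuous_off0 w.
Proof.
move=> cf wE x x0; rewrite /prop_for /continuous_at (wE x x0).
have h := @cvg_scaled_real R R (nbhs x) _ c (glued f) _ (continuous_glued cf x0).
by apply: cvg_trans (h _); apply: near_eq_cvg; exact: near_off0 wE x x0.
Qed.

Lemma glued_weak_derivative c f g w w' : (forall y : R, is_derive y 1 f (g y)) ->
  continuous g ->
  (forall x : R, x != 0 -> w x = c * (glued f x)%:C) ->
  (forall x : R, x != 0 -> w' x = c * (glued g x)%:C) ->
  weak_derivativeC (@punctured_line R) w w'.
Proof.
move=> df cg wE w'E.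
have cw' := glued_continuous_off0 cg w'E.
split; apply: derivative_weak_derivative => x x0.
- have E (y : R) : y != 0 -> complex.Re (w y) = complex.Re c * glued f y.
    by move=> y0; rewrite wE // Re_scaled.
  apply: near_eq_is_derive (near_off0 E x0) _.
  rewrite w'E // Re_scaled.
  exact: (is_deriveZ (complex.Re c) (is_derive_glued df x0)).
- exact: (@cvg_Re R R (nbhs x) _ w' (w' x) (cw' x x0)).
- have E (y : R) : y != 0 -> complex.Im (w y) = complex.Im c * glued f y.
    by move=> y0; rewrite wE // Im_scaled.
  apply: near_eq_is_derive (near_off0 E x0) _.
  rewrite w'E // Im_scaled.
  exact: (is_deriveZ (complex.Im c) (is_derive_glued df x0)).
- exact: (@cvg_Im R R (nbhs x) _ w' (w' x) (cw' x x0)).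
Qed.

Lemma glued_L2 c f w (C k : R) : 0 < k -> continuous f ->
  (forall y, `|f y| <= C * expR (- k * `|y|)) ->
  (forall x : R, x != 0 -> w x = c * (glued f x)%:C) -> L2 w.
Proof.
move=> k0 cf fC wE; have [D fD] := glued_decay (ltW k0) fC.
have cw := glued_continuous_off0 cf wE.
split.
- apply: (@Lfun2_of_decay _ _ (`|complex.Re c| * D) k k0) => x x0.
    exact: (@cvg_Re R R (nbhs x) _ w (w x) (cw x x0)).
  by rewrite wE // Re_scaled normrM -mulrA ler_wpM2l.
- apply: (@Lfun2_of_decay _ _ (`|complex.Im c| * D) k k0) => x x0.
    exact: (@cvg_Im R R (nbhs x) _ w (w x) (cw x x0)).
  by rewrite wE // Im_scaled normrM -mulrA ler_wpM2l.
Qed.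

Lemma glued_cvg_left c f w : continuous f ->
  (forall x : R, x != 0 -> w x = c * (glued f x)%:C) ->
  (w x : Ci) @[x --> (0 : R)^'-] --> (c * (f xm)%:C : Ci).
Proof.
move=> cf wE.
have fl : f (x + xm) @[x --> (0 : R)^'-] --> f xm.
  have := cvg_at_left_filter (@continuous_translate f xm cf 0).
  by rewrite /= add0r.
have h := @cvg_scaled_real R R (0 : R)^'- _ c (fun x => f (x + xm)) _ fl.
apply: cvg_trans (h _); apply: near_eq_cvg; near=> x.
have x0 : x < 0 by [].
by rewrite wE ?lt_eqF // /glued x0.
Unshelve. all: by end_near. Qed.

Lemma glued_cvg_right c f w : continuous f ->
  (forall x : R, x != 0 -> w x = c * (glued f x)%:C) ->
  (w x : Ci) @[x --> (0 : R)^'+] --> (c * (sgn * f xp)%:C : Ci).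
Proof.
move=> cf wE.
have fl : sgn * f (x + xp) @[x --> (0 : R)^'+] --> sgn * f xp.
  apply: cvgM; first exact: cvg_cst.
  have := cvg_at_right_filter (@continuous_translate f xp cf 0).
  by rewrite /= add0r.
have h := @cvg_scaled_real R R (0 : R)^'+ _ c (fun x => sgn * f (x + xp)) _ fl.
apply: cvg_trans (h _); apply: near_eq_cvg; near=> x.
have x0 : 0 < x by [].
by rewrite wE ?gt_eqF // /glued ltNge (ltW x0).
Unshelve. all: by end_near. Qed.

End Glued.

Section Existence.
Variables (R : realType) (mu tau v : R).
Hypotheses (mu0 : 0 < mu) (tau0 : tau != 0) (tau1 : tau != 1) (tauN1 : tau != -1).
Notation Ci := (R[i] : numFieldType).

Definition soliton'' (omega x : R) : R :=
  (omega - soliton mu omega x `^ (2 * mu)) * soliton mu omega x.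

(** Trades the real power for a polynomial in T, from which continuity and boundedness are
    immediate. *)
Lemma soliton''E (omega x : R) : 0 < omega -> soliton'' omega x =
  (omega - omega * (mu + 1) * (1 - T_of mu omega x ^+ 2)) * soliton mu omega x.
Proof. by move=> om0; rewrite /soliton'' soliton_powR. Qed.

Lemma continuous_soliton'' (omega : R) : 0 < omega -> continuous (soliton'' omega).
Proof.
move=> om0 x; apply: is_derive_continuous.
have h1 := is_derive_T_of mu omega x.
have h2 := is_derive_soliton omega mu0 x.
have -> : soliton'' omega = (fun x => (omega + - omega * (mu + 1) +
    omega * (mu + 1) * (T_of mu omega x * T_of mu omega x)) * soliton mu omega x).
  by apply/funext => y; rewrite soliton''E //; ring.
have h3 := is_deriveD (is_derive_cst (omega + - omega * (mu + 1)) x 1)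
  (is_deriveZ (omega * (mu + 1)) (is_deriveM h1 h1)).
exact: (is_deriveM h3 h2).
Qed.

Lemma soliton_bounds (omega : R) : 0 < omega -> exists C : R, forall x,
  [/\ `|soliton mu omega x| <= C * expR (- Num.sqrt omega * `|x|),
      `|soliton' mu omega x| <= C * expR (- Num.sqrt omega * `|x|) &
      `|soliton'' omega x| <= C * expR (- Num.sqrt omega * `|x|)].
Proof.
move=> om0; have [C HC] := soliton_decay omega mu0.
set k := Num.sqrt omega in HC *.
have k0 : 0 <= k by rewrite sqrtr_ge0.
have m1 : 0 < omega * (mu + 1) by rewrite mulr_gt0 // addr_gt0.
(* Dominates the factor in front of the soliton in each function: 1, then [k |T|], then the bracket
   of [soliton''E]. *)
pose K := 1 + k + (omega + omega * (mu + 1)).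
exists (K * C) => x.
have S0 := soliton_gt0 mu0 om0 x.
have le_scaled (c : R) : `|c| <= K -> `|c * soliton mu omega x| <= K * C * expR (- k * `|x|).
  move=> cK; rewrite normrM (gtr0_norm S0) -mulrA.
  by apply: ler_pM => //; first exact: ltW.
have T1 := norm_tanh_lt1 (mu * k * x).
have T2 : 0 <= 1 - T_of mu omega x ^+ 2 <= 1.
  rewrite lerBlDr lerDl sqr_ge0 andbT subr_ge0 -real_normK ?num_real //.
  by rewrite expr_le1 // ltW.
split.
- rewrite -[soliton _ _ _]mul1r; apply: le_scaled; rewrite normr1 /K; lra.
- apply: le_scaled; rewrite normrM normrN (ger0_norm k0).
  apply: (@le_trans _ _ k); last by rewrite /K; lra.
  by rewrite -[leRHS]mulr1 ler_wpM2l // ltW.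
- rewrite soliton''E //; apply: le_scaled.
  have h : 0 <= omega * (mu + 1) * (1 - T_of mu omega x ^+ 2) <= omega * (mu + 1).
    by case/andP: T2 => h1 h2; rewrite mulr_ge0 ?(ltW m1) //= ler_piMr // ltW.
  rewrite ler_norml /K; lra.
Qed.

Lemma form_solution (omega xm xp : R) (u : R -> R[i]) : 0 < omega ->
  T_system mu tau v omega (T_of mu omega xm) (T_of mu omega xp) ->
  phase_equiv u (matched_soliton mu tau omega xm xp) ->
  solution mu tau v omega u.
Proof.
move=> om0 /(vertexE v mu0 tau0 tau1 tauN1 xm xp om0)[v1 v2] [c [c1 uE0]].
have c0 : c != 0.
  by apply: contra_eq_neq c1 => ->; rewrite Normc.normc0 eq_sym oner_eq0.
pose G := glued (Num.sg tau) xm xp.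
have uE (x : R) : x != 0 -> u x = c * (G (soliton mu omega) x)%:C by exact: uE0.
have sg0 : Num.sg tau != 0 by rewrite sgr_eq0.
split.
  exists (-1); have N1 : (-1 : R) != 0 by rewrite oppr_eq0 oner_eq0.
  split => //; rewrite uE // mulf_neq0 // /G /glued ltrN10.
  by rewrite eq_complex /= eqxx andbT gt_eqF // soliton_gt0.
pose u1 x := c * (G (soliton' mu omega) x)%:C.
pose u2 x := c * (G (soliton'' omega) x)%:C.
have [C HC] := soliton_bounds om0.
have k0 : 0 < Num.sqrt omega by rewrite sqrtr_gt0.
have cS := @continuous_soliton R mu mu0 omega.
have cS' := @continuous_soliton' R mu mu0 omega om0.
have cS'' := continuous_soliton'' om0.
have dS (y : R) := is_derive_soliton omega mu0 y : is_derive y 1 _ (soliton' mu omega y).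
have dS' (y : R) := is_derive_soliton2 mu0 om0 y :
  is_derive y 1 (soliton' mu omega) (soliton'' omega y).
have u1E (x : R) : x != 0 -> u1 x = c * (G (soliton' mu omega) x)%:C by [].
have u2E (x : R) : x != 0 -> u2 x = c * (G (soliton'' omega) x)%:C by [].
exists u1, u2; split.
- split.
  + split.
    * have HS y : `|soliton mu omega y| <= C * expR (- Num.sqrt omega * `|y|) by have [] := HC y.
      exact: (glued_L2 k0 cS HS uE).
    * have HS y : `|soliton' mu omega y| <= C * expR (- Num.sqrt omega * `|y|) by have [] := HC y.
      exact: (glued_L2 k0 cS' HS u1E).
    * have HS y : `|soliton'' omega y| <= C * expR (- Num.sqrt omega * `|y|) by have [] := HC y.
      exact: (glued_L2 k0 cS'' HS u2E).
  + exact: (glued_weak_derivative dS cS' uE u1E).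
  + exact: (glued_weak_derivative dS' cS'' u1E u2E).
  + exact: (glued_continuous_off0 cS uE).
  + exact: (glued_continuous_off0 cS' u1E).
- exists set0; split; [exact: measurable0 | exact: measure0 |].
  move=> x; apply => x0; rewrite uE // /u2 Normc.normcM c1 mul1r normc_real.
  have -> : G (soliton'' omega) x =
      (omega - `|G (soliton mu omega) x| `^ (2 * mu)) * G (soliton mu omega) x.
    rewrite /G /glued /soliton''; case: ifP => _.
      by congr ((_ - _ `^ _) * _); apply/esym/gtr0_norm/soliton_gt0.
    rewrite normrM normr_sg tau0 mul1r mulrCA.
    by congr ((_ - _ `^ _) * _); apply/esym/gtr0_norm/soliton_gt0.
  by rewrite real_complexM rmorphB /=; ring.
exists (c * (soliton mu omega xm)%:C), (c * (Num.sg tau * soliton mu omega xp)%:C),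
  (c * (soliton' mu omega xm)%:C), (c * (Num.sg tau * soliton' mu omega xp)%:C).
split; first split.
- exact: (glued_cvg_left cS uE).
- exact: (glued_cvg_right cS uE).
- exact: (glued_cvg_left cS' u1E).
- exact: (glued_cvg_right cS' u1E).
split; last exact/vertex_flux.
by rewrite v1 (mulrA (Num.sg tau)) mulr_sg_norm (real_complexM tau) mulrCA.
Qed.

End Existence.

(** * Branches of solutions *)

Section Branches.
Variables (R : realType) (mu tau v : R).
Hypotheses (mu0 : 0 < mu) (v0 : 0 < v).
Hypotheses (tau0 : tau != 0) (tau1 : tau != 1) (tauN1 : tau != -1).
Implicit Types omega e x : R.

Notation s := (tau ^+ 2).
Notation a := (`|tau| `^ (2 * mu)).
Notation q omega := (v / Num.sqrt omega).

(* [e = -1] is the branch born at [omega_lo], [e = 1] the one at [omega_hi]. *)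
Definition branch_xm e omega : R :=
  artanh (branch_minus s a (q omega) e) / (mu * Num.sqrt omega).
Definition branch_xp e omega : R :=
  artanh (branch_plus s a (q omega) e) / (mu * Num.sqrt omega).
Definition branch_soliton e omega : R -> R[i] :=
  matched_soliton mu tau omega (branch_xm e omega) (branch_xp e omega).

Let s0 : 0 < s. Proof. by rewrite exprn_even_gt0. Qed.
Let a0 : 0 < a. Proof. exact: ratio_gt0. Qed.
Let side : 0 < (a - 1) * (s - 1). Proof. exact: ratio_side. Qed.
Let q0 omega : 0 < omega -> 0 < q omega.
Proof. by move=> om0; rewrite divr_gt0 // sqrtr_gt0. Qed.

Lemma T_of_artanh omega y : 0 < omega -> `|y| < 1 ->
  T_of mu omega (artanh y / (mu * Num.sqrt omega)) = y.
Proof.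
move=> om0 y1; rewrite /T_of mulrC divfK ?artanhK //.
by rewrite mulf_neq0 // gt_eqF // sqrtr_gt0.
Qed.

Lemma T_of_eq omega x y : 0 < omega -> T_of mu omega x = y ->
  x = artanh y / (mu * Num.sqrt omega).
Proof.
move=> om0 <-; rewrite /T_of tanhK mulrC mulKf //.
by rewrite mulf_neq0 // gt_eqF // sqrtr_gt0.
Qed.

(** Used with [c = tau^2 + 1] and [c = tau^2 - 1], it translates the two frequency thresholds into
    the bounds on q from the root analysis. *)
Lemma threshold omega c : 0 < omega -> c != 0 ->
  (v ^+ 2 / c ^+ 2 < omega) = (q omega < `|c|).
Proof.
move=> om0 c0; have k0 : 0 < Num.sqrt omega by rewrite sqrtr_gt0.
have c2 : 0 < c ^+ 2 by rewrite exprn_even_gt0.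
rewrite ltr_pdivrMr // ltr_pdivrMr //.
rewrite -[X in _ = (X < _)](gtr0_norm v0) -sqr_ltE; last first.
  by rewrite mulr_ge0 // ltW.
by rewrite exprMn (real_normK (num_real c)) sqr_sqrtr ?(ltW om0) // subr_gt0 mulrC.
Qed.

Lemma omega_lo_gt0 omega : omega_lo tau v < omega -> 0 < omega.
Proof. by apply: le_lt_trans; rewrite divr_ge0 ?sqr_ge0. Qed.

Lemma omega_hi_gt0 omega : omega_hi tau v < omega -> 0 < omega.
Proof. by apply: le_lt_trans; rewrite divr_ge0 ?sqr_ge0. Qed.

Lemma old_rangeE omega : 0 < omega ->
  (`|branch_minus s a (q omega) (-1)| < 1) = (omega_lo tau v < omega).
Proof.
move=> om0; have s1 : 0 < s + 1 by rewrite addr_gt0.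
rewrite branch_old_range ?q0 // /omega_lo threshold ?gt_eqF //.
by rewrite gtr0_norm.
Qed.

Lemma new_rangeE omega : 0 < omega ->
  (`|branch_minus s a (q omega) 1| < 1) = (omega_hi tau v < omega).
Proof.
move=> om0; rewrite branch_new_range ?q0 // /omega_hi threshold //.
by apply: contraTneq side => ->; rewrite mulr0 ltxx.
Qed.

Lemma branch_equations e omega : e = -1 \/ e = 1 -> 0 < omega ->
  s * branch_plus s a (q omega) e = branch_minus s a (q omega) e + q omega /\
  1 - branch_plus s a (q omega) e ^+ 2 =
    a * (1 - branch_minus s a (q omega) e ^+ 2).
Proof.
by move=> [->|->] om0; apply/(branch_system _ _ s0 a0 (q0 om0) side); [left|right].
Qed.

Lemma branch_T_of e omega : e = -1 \/ e = 1 -> 0 < omega ->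
  `|branch_minus s a (q omega) e| < 1 ->
  T_of mu omega (branch_xm e omega) = branch_minus s a (q omega) e /\
  T_of mu omega (branch_xp e omega) = branch_plus s a (q omega) e.
Proof.
move=> he om0 m1; have [_ E] := branch_equations he om0.
by rewrite !T_of_artanh // (range_iff a0 E).
Qed.

Lemma branch_soliton_solution e omega : e = -1 \/ e = 1 -> 0 < omega ->
  `|branch_minus s a (q omega) e| < 1 ->
  solution mu tau v omega (branch_soliton e omega).
Proof.
move=> he om0 m1; have [Em Ep] := branch_T_of he om0 m1.
apply: (@form_solution R mu tau v mu0 tau0 tau1 tauN1 omega
  (branch_xm e omega) (branch_xp e omega)) => //.
  by apply/T_systemE => //; rewrite Em Ep; exact: branch_equations.
by exists 1; rewrite Normc.normc1; split => // x _; rewrite mul1r.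
Qed.

Lemma old_branch_solution omega : omega_lo tau v < omega ->
  solution mu tau v omega (branch_soliton (-1) omega).
Proof.
move=> lo; have om0 := omega_lo_gt0 lo.
by apply: branch_soliton_solution; [left | | rewrite old_rangeE].
Qed.

Lemma new_branch_solution omega : omega_hi tau v < omega ->
  solution mu tau v omega (branch_soliton 1 omega).
Proof.
move=> hi; have om0 := omega_hi_gt0 hi.
by apply: branch_soliton_solution; [right | | rewrite new_rangeE].
Qed.

(** In a solution T_- is a value of tanh, so [|T| < 1] is automatic. Lying on a root therefore
    forces omega above its threshold, which yields nonexistence and uniqueness together. *)
Lemma solution_on_branch omega (u : R -> R[i]) : solution mu tau v omega u ->
  omega_lo tau v < omega /\ phase_equiv u (branch_soliton (-1) omega) \/
  omega_hi tau v < omega /\ phase_equiv u (branch_soliton 1 omega).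
Proof.
move=> /solution_form[] // om0 [xm [xp [Tsys pe]]].
have Tm1 := norm_tanh_lt1 (mu * Num.sqrt omega * xm).
move/T_systemE: Tsys => /(_ mu0 tau0 tau1 tauN1).
move/(branch_system _ _ s0 a0 (q0 om0) side) => [[Em Ep]|[Em Ep]]; [left|right].
  split; first by rewrite -(old_rangeE om0) -Em; exact: Tm1.
  rewrite /branch_soliton /branch_xm /branch_xp -(T_of_eq om0 Em) -(T_of_eq om0 Ep).
  exact: pe.
split; first by rewrite -(new_rangeE om0) -Em; exact: Tm1.
rewrite /branch_soliton /branch_xm /branch_xp -(T_of_eq om0 Em) -(T_of_eq om0 Ep).
exact: pe.
Qed.

(** The moduli agree on the negative half-line. The soliton is even, so equality at one point does
    not determine the shift; the logarithmic derivative at [- 1] does, since it is a multiple of T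
    and tanh is injective. *)
Lemma phase_equiv_matched omega xm xp xm' xp' : 0 < omega ->
  phase_equiv (matched_soliton mu tau omega xm xp)
    (matched_soliton mu tau omega xm' xp') ->
  T_of mu omega xm = T_of mu omega xm'.
Proof.
move=> om0 [c [c1 E]].
have Sgt := soliton_gt0 mu0 om0.
have ES x : x < 0 -> soliton mu omega (x + xm) = soliton mu omega (x + xm').
  move=> x0; have := congr1 (@Normc.normc R) (E x (ltr0_neq0 x0)).
  rewrite /matched_soliton x0 normc_scaled c1 mul1r normc_real.
  by rewrite (gtr0_norm (Sgt (x + xm))) (gtr0_norm (Sgt (x + xm'))).
suff : -1 + xm = -1 + xm' by move/addrI => ->.
have k0 : 0 < Num.sqrt omega by rewrite sqrtr_gt0.
have d1 := is_derive_translate (is_derive_soliton omega mu0 (-1 + xm)).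
have d2 := is_derive_translate (is_derive_soliton omega mu0 (-1 + xm')).
have d3 : is_derive (-1 : R) 1 (fun x => soliton mu omega (x + xm'))
    (- Num.sqrt omega * T_of mu omega (-1 + xm) * soliton mu omega (-1 + xm)).
  apply: near_eq_is_derive d1; near=> x; apply: ES.
  by near: x; apply: lt_nbhsl; rewrite ltrN10.
have : - Num.sqrt omega * T_of mu omega (-1 + xm) * soliton mu omega (-1 + xm)
   = - Num.sqrt omega * T_of mu omega (-1 + xm') * soliton mu omega (-1 + xm').
  by case: d3 => _ <-; case: d2 => _ <-.
rewrite ES ?ltrN10 //.
move/(mulIf (lt0r_neq0 (Sgt _))); rewrite !mulNr => /oppr_inj /(mulfI (lt0r_neq0 k0)) ET.
by rewrite (T_of_eq om0 ET) -(T_of_eq om0 erefl).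
Unshelve. all: by end_near. Qed.

Lemma branch_solitons_distinct omega : omega_hi tau v < omega ->
  ~ phase_equiv (branch_soliton (-1) omega) (branch_soliton 1 omega).
Proof.
move=> hi; have om0 := omega_hi_gt0 hi; move/phase_equiv_matched => /(_ om0).
have m1 : `|branch_minus s a (q omega) 1| < 1 by rewrite new_rangeE.
have m2 : `|branch_minus s a (q omega) (-1)| < 1.
  rewrite branch_old_range ?q0 //.
  move: m1; rewrite branch_new_range ?q0 // => /lt_le_trans; apply.
  by rewrite ler_norml; have := s0; lra.
have [-> _] := branch_T_of (or_introl erefl) om0 m2.
have [-> _] := branch_T_of (or_intror erefl) om0 m1.
have [r0 _] := branch_radiusP s0 a0 (q0 om0) side.
have A0 : a * s ^+ 2 - 1 != 0.
  by case: (same_side_discr s0 a0 side) => -[_ _ A]; [rewrite gt_eqF|rewrite lt_eqF].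
rewrite /branch_minus => /(mulIf (invr_neq0 A0)).
have : 0 < s * branch_radius s a (q omega) by rewrite mulr_gt0.
lra.
Qed.

Lemma continuous_branch_x omega (f : R -> R) : 0 < omega ->
  {for q omega, continuous f} -> `|f (q omega)| < 1 ->
  {for omega, continuous (fun w => artanh (f (q w)) / (mu * Num.sqrt w))}.
Proof.
move=> om0 cf f1.
have k0 : 0 < Num.sqrt omega by rewrite sqrtr_gt0.
have ck : {for omega, continuous (@Num.sqrt R)} by exact: sqrt_continuous.
have cq : {for omega, continuous (fun w => q w)}.
  apply: continuousM; first exact: cvg_cst.
  by apply: continuousV => //; rewrite gt_eqF.
apply: continuousM.
  apply: (@continuous_comp _ _ _ (fun w => f (q w)) (@artanh R)).
    exact: (@continuous_comp _ _ _ (fun w => q w) f).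
  exact: is_derive_continuous (is_derive_artanh f1).
apply: continuousV; first by rewrite mulf_neq0 // gt_eqF.
by apply: continuousM; first exact: cvg_cst.
Qed.

Lemma continuous_branch_radius x : {for x, continuous (branch_radius s a)}.
Proof.
apply: (@continuous_comp _ _ _ (fun x => a * x ^+ 2 + (a * s ^+ 2 - 1) * (a - 1))
  (@Num.sqrt R)); last exact: sqrt_continuous.
apply: continuousD; last exact: cvg_cst.
by apply: continuousM; [exact: cvg_cst | exact: exprn_continuous].
Qed.

Lemma continuous_branch_minus e x : {for x, continuous (fun y => branch_minus s a y e)}.
Proof.
apply: continuousM; last exact: cvg_cst.
apply: continuousD; first exact: cvg_id.
by apply: continuousM; [exact: cvg_cst | exact: continuous_branch_radius].
Qed.

Lemma continuous_branch_plus e x : {for x, continuous (fun y => branch_plus s a y e)}.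
Proof.
apply: continuousM; last exact: cvg_cst.
apply: continuousD.
  by apply: continuousM; [exact: cvg_cst | exact: cvg_id].
by apply: continuousM; [exact: cvg_cst | exact: continuous_branch_radius].
Qed.

Lemma branch_continuous e omega : e = -1 \/ e = 1 -> 0 < omega ->
  `|branch_minus s a (q omega) e| < 1 ->
  {for omega, continuous (branch_xm e)} /\ {for omega, continuous (branch_xp e)}.
Proof.
move=> he om0 m1; have [_ E] := branch_equations he om0; split.
  apply: (@continuous_branch_x omega (fun y => branch_minus s a y e)) => //.
  exact: continuous_branch_minus.
apply: (@continuous_branch_x omega (fun y => branch_plus s a y e)) => //.
  exact: continuous_branch_plus.
by rewrite (range_iff a0 E).
Qed.

Lemma old_solution_branch :
  solution_branch mu tau v (omega_lo tau v) (branch_xm (-1)) (branch_xp (-1)).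
Proof.
move=> omega lo; have om0 := omega_lo_gt0 lo.
have [||] := @branch_continuous (-1) omega _ om0; first by left.
  by rewrite old_rangeE.
by move=> c1 c2; split => //; exact: old_branch_solution.
Qed.

Lemma new_solution_branch :
  solution_branch mu tau v (omega_hi tau v) (branch_xm 1) (branch_xp 1).
Proof.
move=> omega hi; have om0 := omega_hi_gt0 hi.
have [||] := @branch_continuous 1 omega _ om0; first by right.
  by rewrite new_rangeE.
by move=> c1 c2; split => //; exact: new_branch_solution.
Qed.

Lemma branches_separated :
  separated_branches mu (omega_lo tau v) (omega_hi tau v)
    (branch_xm (-1)) (branch_xp (-1)) (branch_xm 1) (branch_xp 1).
Proof.
have [d d0 H] := branch_separation s0 a0 side.
exists d; split => // w1 w2 lo hi.
have w10 := omega_lo_gt0 lo; have w20 := omega_hi_gt0 hi.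
have [|-> ->] := branch_T_of (or_introl (erefl (-1 : R))) w10; first by rewrite old_rangeE.
have [|-> ->] := branch_T_of (or_intror (erefl (1 : R))) w20; first by rewrite new_rangeE.
by apply: H; exact: q0.
Qed.

End Branches.

Lemma omega_lo_le_hi (R : realType) (tau v : R) : tau != 1 -> tau != -1 ->
  omega_lo tau v <= omega_hi tau v.
Proof.
move=> tau1 tauN1; have t2 := sqr_ge0 tau.
apply: ler_wpM2l; first exact: sqr_ge0.
have p1 : 0 < (tau ^+ 2 + 1) ^+ 2 by rewrite exprn_gt0 // ltr_wpDl.
have p2 : 0 < (tau ^+ 2 - 1) ^+ 2.
  by rewrite exprn_even_gt0 //= subr_eq0 sqrf_eq1 negb_or tau1.
by rewrite lef_pV2 ?posrE //; nra.
Qed.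

Theorem theorem4p2 (R : realType) (mu v tau : R)
    (hmu : 0 < mu) (hv : 0 < v)
    (htau0 : tau != 0) (htau1 : tau != 1) (htauN1 : tau != -1) :
  (* 1 *)
  (forall omega : R, omega <= omega_lo tau v ->
     ~ exists u : R -> R[i], solution mu tau v omega u) /\
  (* 2 *)
  (forall omega : R, omega_lo tau v < omega -> omega <= omega_hi tau v ->
     exists u : R -> R[i], solution mu tau v omega u /\
       forall w : R -> R[i], solution mu tau v omega w -> phase_equiv w u) /\
  (* 3 *)
  (forall omega : R, omega_hi tau v < omega ->
     exists u1 u2 : R -> R[i],
       [/\ solution mu tau v omega u1,
           solution mu tau v omega u2,
           ~ phase_equiv u1 u2
         & forall w : R -> R[i], solution mu tau v omega w ->
             phase_equiv w u1 \/ phase_equiv w u2]) /\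
  (* 3, the separate new branch *)
  (exists xm1 xp1 xm2 xp2 : R -> R,
     [/\ solution_branch mu tau v (omega_lo tau v) xm1 xp1,
         solution_branch mu tau v (omega_hi tau v) xm2 xp2
       & separated_branches mu (omega_lo tau v) (omega_hi tau v)
           xm1 xp1 xm2 xp2]) /\
  (* form of the solutions *)
  (forall (omega : R) (u : R -> R[i]),
     solution mu tau v omega u <->
     0 < omega /\
     exists xm xp : R,
       T_system mu tau v omega (T_of mu omega xm) (T_of mu omega xp) /\
       phase_equiv u (matched_soliton mu tau omega xm xp)).
Proof.
split; [|split; [|split; [|split]]].
- move=> omega lo [u /(solution_on_branch hmu hv htau0 htau1 htauN1)[] [h _]].
    by move: h; rewrite ltNge lo.
  by move: h; rewrite ltNge (le_trans lo) // omega_lo_le_hi.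
- move=> omega lo hi; exists (branch_soliton mu tau v (-1) omega); split.
    exact: old_branch_solution.
  move=> w /(solution_on_branch hmu hv htau0 htau1 htauN1)[[_ //]|[h _]].
  by move: h; rewrite ltNge hi.
- move=> omega hi.
  exists (branch_soliton mu tau v (-1) omega), (branch_soliton mu tau v 1 omega).
  split.
  + apply: old_branch_solution => //.
    by apply: le_lt_trans hi; exact: omega_lo_le_hi.
  + exact: new_branch_solution.
  + exact: branch_solitons_distinct.
  + by move=> w /(solution_on_branch hmu hv htau0 htau1 htauN1)[[_ pe]|[_ pe]]; [left|right].
- exists (branch_xm mu tau v (-1)), (branch_xp mu tau v (-1)),
    (branch_xm mu tau v 1), (branch_xp mu tau v 1); split.
  + exact: old_solution_branch.
  + exact: new_solution_branch.
  + exact: branches_separated.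
- move=> omega u; split; first exact: solution_form.
  by move=> [om0 [xm [xp [Tsys pe]]]]; exact: form_solution Tsys pe.
Qed.
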